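(* Let $f(z)=z+a_2z^2+a_3z^3+\cdots\in\mathcal{S}^*_G$. Then $$|a_3^2-a_5|\le\frac18.$$ The inequality is sharp, i.e. there exists $f\in\mathcal{S}^*_G$ for which equality holds.
   Context: Let $\mathbb{D}=\{z\in\mathbb{C}:|z|<1\}$ and let $\mathcal{A}$ be the class of holomorphic functions $f$ on $\mathbb{D}$ with $f(0)=0$, $f'(0)=1$, i.e. $f(z)=z+\sum_{n\ge2}a_nz^n$. For analytic $g,h$ on $\mathbb{D}$, $g\prec h$ ($g$ is subordinate to $h$) means that there is an analytic $\omega:\mathbb{D}\to\mathbb{C}$ with $\omega(0)=0$ and $|\omega(z)|<1$ on $\mathbb{D}$ such that $g(z)=h(\omega(z))$ for all $z\in\mathbb{D}$. Let $\Psi(z)=\dfrac{z}{\ln(1+z)}$ for $z\in\mathbb{D}$ (principal branch of the logarithm, $\Psi(0)=1$); its Taylor coefficients at $0$ are the Gregory coefficients, $\Psi(z)=1+\frac12z-\frac1{12}z^2+\frac1{24}z^3-\frac{19}{720}z^4+\cdots$. Define $$\mathcal{S}^*_G=\left\{f\in\mathcal{A}:\ \frac{zf'(z)}{f(z)}\prec\Psi(z)\right\},$$ where $zf'(z)/f(z)$ is understood to take the value $1$ at $z=0$. *)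

(* Defs.v *)
From Stdlib Require Import Reals Lra.
From Coquelicot Require Export Coquelicot.
Open Scope R_scope.
Open Scope C_scope.

Definition in_disc (z : C) : Prop := (Cmod z < 1)%R.

(* Complex differentiability at every point of the unit disc.  Functions are
   total on [C]; their values outside the disc are irrelevant, since the disc
   is open. *)
Definition holomorphic_on_disc (f : C -> C) : Prop :=
  forall z : C, in_disc z -> ex_derive (K := C_AbsRing) (V := C_NormedModule) f z.

Definition subordinate (g h : C -> C) : Prop :=
  holomorphic_on_disc g /\ holomorphic_on_disc h /\
  exists w : C -> C,
    holomorphic_on_disc w /\ w 0 = 0 /\
    (forall z : C, in_disc z -> (Cmod (w z) < 1)%R) /\
    (forall z : C, in_disc z -> g z = h (w z)).

Definition class_A (f : C -> C) : Prop :=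
  holomorphic_on_disc f /\ f 0 = 0 /\ C_derive f 0 = 1.

(* Principal argument, in (-PI, PI]; the value at 0 is junk. *)
Definition Arg (z : C) : R :=
  if Rlt_dec 0 (Re z) then atan (Im z / Re z)
  else if Rlt_dec 0 (Im z) then (PI / 2 - atan (Re z / Im z))%R
  else if Rlt_dec (Im z) 0 then (- (PI / 2) - atan (Re z / Im z))%R
  else PI.

Definition Clog (z : C) : C := (ln (Cmod z), Arg z).

Lemma Arg_bounds (z : C) : (- PI < Arg z <= PI)%R.
Proof.
  unfold Arg. pose proof PI_RGT_0.
  pose proof (atan_bound (Im z / Re z)). pose proof (atan_bound (Re z / Im z)).
  destruct (Rlt_dec 0 (Re z)) as [hx|hx]; [lra|].
  destruct (Rlt_dec 0 (Im z)) as [hy|hy]; [lra|].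
  destruct (Rlt_dec (Im z) 0) as [hy'|hy']; [|lra].
  assert (0 <= Re z / Im z)%R.
  { replace (Re z / Im z)%R with ((- Re z) / (- Im z))%R by (field; lra).
    apply Rmult_le_pos; [lra|]. left; apply Rinv_0_lt_compat; lra. }
  destruct (Req_dec (Re z / Im z) 0) as [e|e].
  - rewrite e, atan_0. lra.
  - assert (atan 0 < atan (Re z / Im z))%R by (apply atan_increasing; lra).
    rewrite atan_0 in *. lra.
Qed.

Lemma polar_Arg (z : C) :
  z <> 0 -> z = ((Cmod z * cos (Arg z))%R, (Cmod z * sin (Arg z))%R).
Proof.
  destruct z as [x y]; intros hz.
  assert (key : forall u v : R, (0 < u)%R ->
    (sqrt (u ^ 2 + v ^ 2) * cos (atan (v / u)) = u /\
     sqrt (u ^ 2 + v ^ 2) * sin (atan (v / u)) = v)%R).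
  { intros u v hu.
    assert (hs : sqrt (u ^ 2 + v ^ 2) = (u * sqrt (1 + (v / u)²))%R).
    { rewrite <- (sqrt_pow2 u) at 2 by lra.
      rewrite <- sqrt_mult; [| apply pow2_ge_0 | pose proof (Rle_0_sqr (v/u)); lra].
      f_equal. unfold Rsqr. field. lra. }
    assert (0 < sqrt (1 + (v / u)²))%R
      by (apply sqrt_lt_R0; pose proof (Rle_0_sqr (v/u)); lra).
    rewrite cos_atan, sin_atan, hs. split; field; lra. }
  unfold Arg, Cmod; simpl Re; simpl Im; simpl fst; simpl snd.
  destruct (Rlt_dec 0 x) as [hx|hx].
  { destruct (key x y hx) as [-> ->]. reflexivity. }
  destruct (Rlt_dec 0 y) as [hy|hy].
  { rewrite cos_shift, sin_shift, Rplus_comm.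
    destruct (key y x hy) as [-> ->]. reflexivity. }
  destruct (Rlt_dec y 0) as [hy'|hy'].
  { destruct (key (- y)%R (- x)%R ltac:(lra)) as [e1 e2].
    replace (- x / - y)%R with (x / y)%R in * by (field; lra).
    replace (- (PI / 2) - atan (x / y))%R
      with (- (PI / 2 - (- atan (x / y))))%R by ring.
    rewrite cos_neg, sin_neg, cos_shift, sin_shift, sin_neg, cos_neg.
    replace (x ^ 2 + y ^ 2)%R with ((- y) ^ 2 + (- x) ^ 2)%R by ring.
    f_equal; lra. }
  assert (y = 0%R) by lra; subst y.
  rewrite cos_PI, sin_PI.
  replace (x ^ 2 + 0 ^ 2)%R with ((- x) ^ 2)%R by ring.
  rewrite sqrt_pow2 by lra. f_equal; ring.
Qed.

Definition Psi (z : C) : C :=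
  if Ceq_dec z 0 then 1 else z / Clog (1 + z).

Definition zf'_over_f (f : C -> C) (z : C) : C :=
  if Ceq_dec z 0 then 1 else z * C_derive f z / f z.

(* The nonvanishing clause says that zf'/f is well defined on the disc: division
   by zero is total on [C]. *)
Definition class_SG (f : C -> C) : Prop :=
  class_A f /\
  (forall z : C, in_disc z -> z <> 0 -> f z <> 0) /\
  subordinate (zf'_over_f f) Psi.

Definition taylor_on_disc (f : C -> C) (a : nat -> C) : Prop :=
  forall z : C, in_disc z -> is_pseries (K := C_AbsRing) (V := C_NormedModule) a z (f z).

(* Main.v *)
(* With [w = c1 z + c2 z^2 + ...] the Schwarz function of [z f'/f], comparing
   coefficients gives
     [a3^2 - a5 = - L / 8,
      L = c4 + c1 c3 / 3 - (5/12) c2^2 - (5/36) c1^2 c2 - c1^4 / 15].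
   Since [|w| <= 1], multiplication by [w] does not increase the quadratic mean on
   circles, so the lower triangular Toeplitz matrix of [c1, ..., c4] is a contraction.
   Applied to the vector
     [(1, c1/3, - (5/12) (c2 + c1^2/3), - c1^3/15)]
   it yields a vector whose last entry is exactly [L] and whose first two are [c1] and
   [c2 + c1^2/3]; as [|c1| <= 1], comparing norms gives [|L| <= 1].
   Only Goursat's theorem is needed from Cauchy's theory, because the means over all
   circles can be compared with the expansion of [w] at [0], which is read off the
   Taylor series of [f].

   Equality holds for [w = z^4].  Kaluza's theorem bounds the Gregory coefficients by 1,
   so [Psi] equals its Taylor series on the whole disc, and [z f' = f Psi(z^4)] can be
   solved by a power series with coefficients bounded by 1.  The same equation with the
   opposite sign gives the reciprocal of [f/z], so that [f] has no other zero. *)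

Require Import Defs.
From Stdlib Require Import Reals Lra Lia ClassicalEpsilon.
From Coquelicot Require Import Coquelicot.
Open Scope C_scope.

(** * Complex derivatives and the exponential *)

(** The entries of the test vector are forced one at a time: a first entry 1 produces [c4], then
    [c1/3] produces [c1 c3 / 3], the terms divisible by [c2] leave [- (5/12) c2 - (5/36) c1^2], and
    [c1^4] is left to the last entry. The bound works because the third entry is then [-5/12] times
    the second entry [c2 + c1^2/3] of the image, so that its square is absorbed. The obstacle is
    that [w] is only known to be complex differentiable, so no power series for it may be assumed.
    Its expansion to order 4 is a [bigO 5] statement at 0, obtained by inverting [Psi] to that
    order, and quotients such as [(H - T) / z^5], with [T] a Taylor polynomial, are only required to
    be holomorphic off 0 and bounded near 0. The singularity is never filled in: in the coordinate
    [z = exp (s + i t)] circles become vertical segments and the puncture goes to [s = -oo]; Goursat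
    on rectangles makes means independent of [s], and a function that is [O(z)] then has mean 0. *)

Definition is_Cderive (f : C -> C) (z l : C) : Prop :=
  is_derive (K := C_AbsRing) (V := C_NormedModule) f z l.

Lemma is_Cderive_eps (f : C -> C) (z l : C) :
  is_Cderive f z l <->
  (forall eps : R, 0 < eps -> exists delta : R, 0 < delta /\
     forall y : C, Cmod (y - z) < delta ->
       Cmod (f y - f z - l * (y - z)) <= eps * Cmod (y - z))%R.
Proof.
  split.
  - intros [_ H] eps He.
    destruct (H z (fun P HP => HP) (mkposreal eps He)) as [d Hd].
    exists d. split. apply cond_pos.
    intros y Hy. specialize (Hd y Hy).
    rewrite (Cmult_comm l). exact Hd.
  - intros H. split.
    + exact (@is_linear_scal_l C_AbsRing C_NormedModule l).
    + intros x Hx eps.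
      assert (e : z = x).
      { apply (is_filter_lim_locally_unique (K := C_AbsRing)
          (V := AbsRing_NormedModule C_AbsRing)). exact Hx. }
      subst x.
      destruct (H eps (cond_pos eps)) as (d & Hd & Hy).
      exists (mkposreal d Hd). intros y By. specialize (Hy y By).
      rewrite (Cmult_comm l) in Hy. exact Hy.
Qed.

Lemma is_Cderive_ext (f g : C -> C) (z l l' : C) :
  (forall x, f x = g x) -> l = l' -> is_Cderive f z l -> is_Cderive g z l'.
Proof. intros H <- Hf. exact (is_derive_ext f g z l H Hf). Qed.

Lemma is_Cderive_ext_loc (f g : C -> C) (z l : C) (r : R) :
  (0 < r)%R -> (forall x, (Cmod (x - z) < r)%R -> f x = g x) ->
  is_Cderive f z l -> is_Cderive g z l.
Proof.
  intros Hr H. rewrite !is_Cderive_eps. intros Hf eps He.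
  destruct (Hf eps He) as (d & Hd & Hy). exists (Rmin d r).
  split. apply Rmin_glb_lt; assumption.
  intros y By. rewrite <- !H.
  - apply Hy. eapply Rlt_le_trans. apply By. apply Rmin_l.
  - replace (z - z) with (RtoC 0) by ring. now rewrite Cmod_0.
  - eapply Rlt_le_trans. apply By. apply Rmin_r.
Qed.

(* Coquelicot's rules for products and compositions use the normed module of the
   absolute ring [C], whose uniform structure differs from that of
   [C_NormedModule]. *)
Lemma is_Cderive_AbsRing (f : C -> C) (z l : C) :
  is_Cderive f z l <->
  is_derive (K := C_AbsRing) (V := AbsRing_NormedModule C_AbsRing) f z l.
Proof.
  split; intros [_ B]; split; try exact B.
  - exact (@is_linear_scal_l C_AbsRing (AbsRing_NormedModule C_AbsRing) l).
  - exact (@is_linear_scal_l C_AbsRing C_NormedModule l).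
Qed.

Lemma is_Cderive_const (c z : C) : is_Cderive (fun _ => c) z 0.
Proof. exact (@is_derive_const C_AbsRing C_NormedModule c z). Qed.

Lemma is_Cderive_id (z : C) : is_Cderive (fun x => x) z 1.
Proof. apply is_Cderive_AbsRing. exact (@is_derive_id C_AbsRing z). Qed.

Lemma is_Cderive_plus (f g : C -> C) (z df dg : C) :
  is_Cderive f z df -> is_Cderive g z dg ->
  is_Cderive (fun x => f x + g x) z (df + dg).
Proof. exact (@is_derive_plus C_AbsRing C_NormedModule f g z df dg). Qed.

Lemma is_Cderive_mult (f g : C -> C) (z df dg : C) :
  is_Cderive f z df -> is_Cderive g z dg ->
  is_Cderive (fun x => f x * g x) z (df * g z + f z * dg).
Proof.
  rewrite !is_Cderive_AbsRing. intros Hf Hg.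
  exact (@is_derive_mult C_AbsRing f g z df dg Hf Hg Cmult_comm).
Qed.

Lemma is_Cderive_comp (f g : C -> C) (z df dg : C) :
  is_Cderive f (g z) df -> is_Cderive g z dg ->
  is_Cderive (fun x => f (g x)) z (dg * df).
Proof.
  rewrite !is_Cderive_AbsRing.
  exact (@is_derive_comp C_AbsRing (AbsRing_NormedModule C_AbsRing) f g z df dg).
Qed.

Lemma is_Cderive_minus (f g : C -> C) (z df dg : C) :
  is_Cderive f z df -> is_Cderive g z dg ->
  is_Cderive (fun x => f x - g x) z (df - dg).
Proof. exact (@is_derive_minus C_AbsRing C_NormedModule f g z df dg). Qed.

Lemma Cmod_le_diff (a b : C) : (Cmod a - Cmod b <= Cmod (a - b))%R.
Proof.
  pose proof (Cmod_triangle (a - b) b).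
  replace (a - b + b) with a in H by ring. lra.
Qed.

Lemma is_Cderive_inv (z : C) : z <> 0 -> is_Cderive (fun x => / x) z (- / (z * z)).
Proof.
  intros Hz. apply is_Cderive_eps. intros eps He.
  assert (Hm : (0 < Cmod z)%R) by now apply Cmod_gt_0.
  set (m := Cmod z) in *.
  (* The error is [(y - z)^2 / (y z^2)]. The first radius keeps [|y| > m / 2], so the denominator
     exceeds [m^3 / 2]; the second radius is [eps] times that. *)
  exists (Rmin (m / 2) (eps * (m * m * m) / 2)).
  assert (0 < m * m * m)%R by (repeat apply Rmult_lt_0_compat; lra).
  split. { apply Rmin_glb_lt; [lra|]. apply Rdiv_lt_0_compat; nra. }
  intros y Hy.
  assert (H1 : (Cmod (y - z) < m / 2)%R)
    by (eapply Rlt_le_trans; [apply Hy|apply Rmin_l]).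
  assert (H2 : (Cmod (y - z) < eps * (m * m * m) / 2)%R)
    by (eapply Rlt_le_trans; [apply Hy|apply Rmin_r]).
  assert (Hmy : (m / 2 < Cmod y)%R).
  { pose proof (Cmod_le_diff z (z - y)) as T.
    replace (z - (z - y)) with y in T by ring.
    replace (Cmod (z - y)) with (Cmod (y - z)) in T.
    - fold m in T. lra.
    - rewrite <- Cmod_opp. f_equal. ring. }
  assert (Hy0 : y <> 0) by (apply Cmod_gt_0; lra).
  replace (/ y - / z - - / (z * z) * (y - z))
    with ((y - z) * ((y - z) / (y * (z * z)))) by (field; now split).
  rewrite Cmod_mult, Rmult_comm. apply Rmult_le_compat_r. apply Cmod_ge_0.
  rewrite Cmod_div by (repeat apply Cmult_neq_0; assumption).
  rewrite !Cmod_mult. fold m.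
  assert (Hp : (m * m * m / 2 < Cmod y * (m * m))%R).
  { replace (m * m * m / 2)%R with (m / 2 * (m * m))%R by field.
    apply Rmult_lt_compat_r; nra. }
  apply Rmult_le_reg_r with (Cmod y * (m * m))%R. lra.
  unfold Rdiv. rewrite Rmult_assoc, Rinv_l by lra.
  nra.
Qed.

Lemma is_Cderive_pow (n : nat) (z : C) :
  is_Cderive (fun x => x ^ S n) z (RtoC (INR (S n)) * z ^ n).
Proof.
  induction n as [|n IH].
  - apply (is_Cderive_ext (fun x => x) _ z 1); [intros; simpl; ring| |apply is_Cderive_id].
    simpl. ring.
  - eapply is_Cderive_ext; [| |exact (is_Cderive_mult _ _ _ _ _ (is_Cderive_id z) IH)].
    + intros x. simpl. ring.
    + rewrite (S_INR (S n)), RtoC_plus. simpl Cpow. ring.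
Qed.

Definition Cexp (z : C) : C := ((exp (Re z) * cos (Im z))%R, (exp (Re z) * sin (Im z))%R).

Lemma Cexp_plus (z w : C) : Cexp (z + w) = Cexp z * Cexp w.
Proof.
  unfold Cexp. destruct z as [a b], w as [c d]. simpl.
  rewrite exp_plus, cos_plus, sin_plus. unfold Cmult; simpl. f_equal; ring.
Qed.

Lemma derive_eps (f : R -> R) (x l : R) :
  is_derive f x l -> forall eps : R, (0 < eps)%R -> exists delta : R, (0 < delta)%R /\
     forall y : R, (Rabs (y - x) < delta ->
       Rabs (f y - f x - l * (y - x)) <= eps * Rabs (y - x))%R.
Proof.
  intros [_ H] eps He.
  destruct (H x (fun P HP => HP) (mkposreal eps He)) as [d Hd].
  exists d. split. apply cond_pos.
  intros y Hy. specialize (Hd y Hy).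
  rewrite (Rmult_comm l). exact Hd.
Qed.

Lemma Cmod_le_abs (x y : R) : (Cmod (x, y) <= Rabs x + Rabs y)%R.
Proof.
  unfold Cmod; simpl fst; simpl snd.
  apply Rle_trans with (sqrt ((Rabs x + Rabs y) ^ 2)).
  - apply sqrt_le_1_alt. rewrite <- (pow2_abs x), <- (pow2_abs y).
    pose proof (Rabs_pos x). pose proof (Rabs_pos y). nra.
  - rewrite sqrt_pow2. lra. pose proof (Rabs_pos x). pose proof (Rabs_pos y). lra.
Qed.

Lemma Im_le_Cmod (z : C) : (Rabs (Im z) <= Cmod z)%R.
Proof. eapply Rle_trans; [|apply Rmax_Cmod]. apply Rmax_r. Qed.

Lemma is_Cderive_exp_0 : is_Cderive Cexp 0 1.
Proof.
  apply is_Cderive_eps. intros eps He.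
  (* The errors of the real and the imaginary part come out as [4 e m] and [5 e m], whence the 9.
     Besides the three radii of differentiability, [e] itself bounds [|y|], which keeps the mixed
     term [(a + X) * b] below [2 e m]. *)
  set (e := Rmin (eps / 9) 1).
  assert (he : (0 < e <= 1)%R).
  { split. apply Rmin_glb_lt; lra. apply Rmin_r. }
  assert (he8 : (e <= eps / 9)%R) by apply Rmin_l.
  destruct (derive_eps exp 0 1 ltac:(auto_derive; [trivial|rewrite exp_0; ring]) e (proj1 he)) as (d1 & Hd1 & H1).
  destruct (derive_eps cos 0 0 ltac:(auto_derive; [trivial|rewrite sin_0; ring]) e (proj1 he)) as (d2 & Hd2 & H2).
  destruct (derive_eps sin 0 1 ltac:(auto_derive; [trivial|rewrite cos_0; ring]) e (proj1 he)) as (d3 & Hd3 & H3).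
  exists (Rmin (Rmin d1 e) (Rmin d2 d3)).
  split. { repeat apply Rmin_glb_lt; lra. }
  intros y Hy. replace (y - 0) with y in * by ring.
  assert (T := Rmin_l (Rmin d1 e) (Rmin d2 d3)). assert (T' := Rmin_r (Rmin d1 e) (Rmin d2 d3)).
  assert (T1 := Rmin_l d1 e). assert (T2 := Rmin_r d1 e).
  assert (T3 := Rmin_l d2 d3). assert (T4 := Rmin_r d2 d3).
  assert (Hx := re_le_Cmod y). assert (Hi := Im_le_Cmod y).
  set (m := Cmod y) in *. destruct y as [a b]. simpl in Hx, Hi.
  specialize (H1 a). specialize (H2 b). specialize (H3 b).
  rewrite !Rminus_0_r in H1, H2, H3.
  specialize (H1 ltac:(lra)). specialize (H2 ltac:(lra)). specialize (H3 ltac:(lra)).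
  rewrite exp_0 in H1. rewrite cos_0 in H2. rewrite sin_0 in H3.
  assert (E : Cexp (a, b) - Cexp 0 - 1 * (a, b) =
    ((exp a * cos b - 1 - a)%R, (exp a * sin b - b)%R)).
  { unfold Cexp. simpl. rewrite exp_0, cos_0, sin_0.
    unfold Cminus, Cplus, Copp, Cmult; simpl. f_equal; ring. }
  rewrite E. eapply Rle_trans. apply Cmod_le_abs.
  set (X := (exp a - 1 - 1 * a)%R) in *.
  set (Y := (cos b - 1 - 0 * b)%R) in *.
  set (Z := (sin b - 0 - 1 * b)%R) in *.
  assert (Ea : exp a = (1 + a + X)%R) by (unfold X; ring).
  replace (exp a * cos b - 1 - a)%R with ((1 + a + X) * Y + X)%R by (rewrite <- Ea; unfold X, Y; ring).
  replace (exp a * sin b - b)%R with ((1 + a + X) * Z + (a + X) * b)%R by (rewrite <- Ea; unfold X, Z; rewrite Ea; unfold X; ring).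
  assert (Hm : (0 <= m)%R) by apply Cmod_ge_0.
  assert (Hm1 : (m < e)%R) by lra.
  assert (BX : (Rabs X <= e * m)%R) by nra.
  assert (BY : (Rabs Y <= e * m)%R) by nra.
  assert (BZ : (Rabs Z <= e * m)%R) by nra.
  assert (BA : (Rabs (1 + a + X) <= 3)%R).
  { eapply Rle_trans. apply Rabs_triang. 
    assert (Rabs (1 + a) <= 1 + Rabs a)%R.
    { eapply Rle_trans. apply Rabs_triang. rewrite Rabs_R1. lra. } nra. }
  assert (BB : (Rabs (a + X) <= 2 * e)%R).
  { eapply Rle_trans. apply Rabs_triang. nra. }
  assert (Rabs ((1 + a + X) * Y + X) <= 4 * e * m)%R.
  { eapply Rle_trans. apply Rabs_triang. rewrite Rabs_mult.
    assert (Rabs (1 + a + X) * Rabs Y <= 3 * (e * m))%R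
      by (apply Rmult_le_compat; try apply Rabs_pos; lra).
    lra. }
  assert (Rabs ((1 + a + X) * Z + (a + X) * b) <= 5 * e * m)%R.
  { eapply Rle_trans. apply Rabs_triang. rewrite !Rabs_mult.
    assert (Rabs (1 + a + X) * Rabs Z <= 3 * (e * m))%R
      by (apply Rmult_le_compat; try apply Rabs_pos; lra).
    assert (Rabs (a + X) * Rabs b <= 2 * e * m)%R
      by (apply Rmult_le_compat; try apply Rabs_pos; lra).
    lra. }
  assert (9 * e * m <= eps * m)%R by (apply Rmult_le_compat_r; lra).
  lra.
Qed.

Lemma is_Cderive_exp (z : C) : is_Cderive Cexp z (Cexp z).
Proof.
  apply (is_Cderive_ext (fun x => Cexp z * Cexp (x - z)) _ z (Cexp z)); [|reflexivity|].
  - intros x. rewrite <- Cexp_plus. f_equal. ring.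
  - eapply is_Cderive_ext; [reflexivity| |
      apply is_Cderive_mult; [apply is_Cderive_const|
        apply (is_Cderive_comp Cexp (fun x => x - z) z 1 (1 - 0))]].
    + replace (z - z) with (RtoC 0) by ring. simpl. ring.
    + replace (z - z) with (RtoC 0) by ring. apply is_Cderive_exp_0.
    + apply is_Cderive_minus. apply is_Cderive_id. apply is_Cderive_const.
Qed.

Lemma Cmod_Cexp (z : C) : Cmod (Cexp z) = exp (Re z).
Proof.
  unfold Cexp, Cmod; simpl fst; simpl snd.
  replace ((exp (Re z) * cos (Im z)) ^ 2 + (exp (Re z) * sin (Im z)) ^ 2)%R
    with (exp (Re z) ^ 2)%R.
  - apply sqrt_pow2. left. apply exp_pos.
  - pose proof (sin2_cos2 (Im z)) as H. unfold Rsqr in H.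
    transitivity (exp (Re z) ^ 2 * (sin (Im z) * sin (Im z) + cos (Im z) * cos (Im z)))%R.
    rewrite H. ring. ring.
Qed.

(** * Goursat's theorem for closed forms on rectangles *)

Open Scope R_scope.

(** Produces the sequence of rectangles in the bisection. A successor is promised only for states
    satisfying [Inv], so the recursion runs on states paired with a proof of it. *)
Lemma dependent_choice (T : Type) (Inv : nat -> T -> Prop) (step : nat -> T -> T -> Prop) (t0 : T) :
  Inv 0%nat t0 ->
  (forall n t, Inv n t -> exists t', Inv (S n) t' /\ step n t t') ->
  exists s : nat -> T, s 0%nat = t0 /\
    forall n, Inv n (s n) /\ step n (s n) (s (S n)).
Proof.
  intros H0 H.
  pose (nxt := fun n (t : {t | Inv n t}) =>
    constructive_indefinite_description _ (H n (proj1_sig t) (proj2_sig t))).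
  pose (sq := fix sq n : {t | Inv n t} := match n with
    | O => exist _ t0 H0
    | S m => exist _ (proj1_sig (nxt m (sq m))) (proj1 (proj2_sig (nxt m (sq m)))) end).
  exists (fun n => proj1_sig (sq n)). split. reflexivity.
  intros n. split. apply (proj2_sig (sq n)).
  exact (proj2 (proj2_sig (nxt n (sq n)))).
Qed.

(** The left endpoints increase and stay below every right endpoint, so their supremum lies in all
    the intervals. *)
Lemma nested_halving (x : nat -> R) (w : R) :
  0 <= w ->
  (forall n, x n <= x (S n) /\ x (S n) + w / 2 ^ S n <= x n + w / 2 ^ n) ->
  exists l, forall n, x n <= l <= x n + w / 2 ^ n.
Proof.
  intros Hw H.
  assert (Hpos : forall n, 0 <= w / 2 ^ n).
  { intros n. apply Rmult_le_pos; [assumption|]. left. apply Rinv_0_lt_compat, pow_lt; lra. }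
  assert (Hm : forall n k, x n <= x (n + k)%nat /\ x (n + k)%nat + w / 2 ^ (n + k) <= x n + w / 2 ^ n).
  { intros n k. induction k as [|k IH].
    - rewrite Nat.add_0_r. lra.
    - rewrite Nat.add_succ_r. pose proof (H (n + k)%nat). lra. }
  assert (Hub : forall n m, x m <= x n + w / 2 ^ n).
  { intros n m. destruct (Nat.le_ge_cases n m) as [h|h].
    - replace m with (n + (m - n))%nat by lia. pose proof (Hm n (m - n)%nat).
      pose proof (Hpos (n + (m - n))%nat). lra.
    - replace n with (m + (n - m))%nat by lia. pose proof (Hm m (n - m)%nat).
      pose proof (Hpos (m + (n - m))%nat). lra. }
  destruct (completeness (fun y => exists n, y = x n)) as [l [Hl1 Hl2]].
  - exists (x 0%nat + w / 2 ^ 0). intros y [n ->]. apply Hub.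
  - exists (x 0%nat). now exists 0%nat.
  - exists l. intros n. split.
    + apply Hl1. now exists n.
    + apply Hl2. intros y [m ->]. apply Hub.
Qed.

(** The integral of [P dx + Q dy] counterclockwise around the rectangle [[a, b] x [c, d]]. *)
Definition circulation (P Q : R -> R -> R) (a b c d : R) : R :=
  RInt (fun x => P x c) a b + RInt (fun y => Q b y) c d
  - RInt (fun x => P x d) a b - RInt (fun y => Q a y) c d.

(** The shared [r] expresses [dP/dy = dQ/dx] at the point. Only total differentiability is asked, as
    a holomorphic function provides no more before Cauchy's theory. *)
Definition closed_form_at (P Q : R -> R -> R) (x y : R) : Prop :=
  exists px r qy, differentiable_pt_lim P x y px r /\ differentiable_pt_lim Q x y r qy.

Lemma differentiable_continuous_fst (f : R -> R -> R) (x y lx ly : R) :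
  differentiable_pt_lim f x y lx ly -> continuous (fun u => f u y) x.
Proof.
  intros H. apply continuity_pt_filterlim.
  assert (H' : continuity_2d_pt f x y).
  { apply differentiable_continuity_pt. now exists lx, ly. }
  apply continuity_pt_locally. intros eps. destruct (H' eps) as [d Hd].
  exists d. intros u Hu. apply Hd. exact Hu. rewrite Rminus_diag, Rabs_R0. apply cond_pos.
Qed.

Lemma differentiable_continuous_snd (f : R -> R -> R) (x y lx ly : R) :
  differentiable_pt_lim f x y lx ly -> continuous (fun v => f x v) y.
Proof.
  intros H. apply continuity_pt_filterlim.
  assert (H' : continuity_2d_pt f x y).
  { apply differentiable_continuity_pt. now exists lx, ly. }
  apply continuity_pt_locally. intros eps. destruct (H' eps) as [d Hd].
  exists d. intros u Hu. apply Hd; [|exact Hu]. rewrite Rminus_diag, Rabs_R0. apply cond_pos.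
Qed.

Definition closed_form_on (P Q : R -> R -> R) (a b c d : R) : Prop :=
  forall x y, a <= x <= b -> c <= y <= d -> closed_form_at P Q x y.

Lemma closed_form_ex_RInt_fst (P Q : R -> R -> R) (a b c d : R) :
  closed_form_on P Q a b c d -> forall x1 x2 y, a <= x1 <= x2 -> x2 <= b -> c <= y <= d ->
  ex_RInt (fun x => P x y) x1 x2.
Proof.
  intros H x1 x2 y H1 H2 Hy. apply (ex_RInt_continuous (V := R_CompleteNormedModule)).
  intros z Hz. rewrite Rmin_left, Rmax_right in Hz by lra.
  destruct (H z y ltac:(lra) Hy) as (px & r & qy & D & _).
  exact (differentiable_continuous_fst _ _ _ _ _ D).
Qed.

Lemma closed_form_ex_RInt_snd (P Q : R -> R -> R) (a b c d : R) :
  closed_form_on P Q a b c d -> forall y1 y2 x, c <= y1 <= y2 -> y2 <= d -> a <= x <= b ->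
  ex_RInt (fun y => Q x y) y1 y2.
Proof.
  intros H y1 y2 x H1 H2 Hx. apply (ex_RInt_continuous (V := R_CompleteNormedModule)).
  intros z Hz. rewrite Rmin_left, Rmax_right in Hz by lra.
  destruct (H x z Hx ltac:(lra)) as (px & r & qy & _ & D).
  exact (differentiable_continuous_snd _ _ _ _ _ D).
Qed.

Lemma closed_form_on_sub (P Q : R -> R -> R) (a b c d a' b' c' d' : R) :
  closed_form_on P Q a b c d -> a <= a' -> b' <= b -> c <= c' -> d' <= d ->
  closed_form_on P Q a' b' c' d'.
Proof. intros H ? ? ? ? x y Hx Hy. apply H; lra. Qed.

Lemma circulation_split (P Q : R -> R -> R) (a m b c n d : R) :
  a <= m <= b -> c <= n <= d -> closed_form_on P Q a b c d ->
  circulation P Q a b c d =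
    circulation P Q a m c n + circulation P Q m b c n
    + circulation P Q a m n d + circulation P Q m b n d.
Proof.
  intros Hm Hn H. unfold circulation.
  assert (EP : forall y, c <= y <= d ->
    RInt (fun x => P x y) a b = RInt (fun x => P x y) a m + RInt (fun x => P x y) m b).
  { intros y Hy. symmetry. apply (RInt_Chasles (V := R_CompleteNormedModule));
      eapply closed_form_ex_RInt_fst; try eassumption; lra. }
  assert (EQ : forall x, a <= x <= b ->
    RInt (fun y => Q x y) c d = RInt (fun y => Q x y) c n + RInt (fun y => Q x y) n d).
  { intros x Hx. symmetry. apply (RInt_Chasles (V := R_CompleteNormedModule));
      eapply closed_form_ex_RInt_snd; try eassumption; lra. }
  rewrite !EP, !EQ by lra. ring.
Qed.

(** An affine form with [dP/dy = dQ/dx] has circulation 0, so only the deviation from the affine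
    part counts: at most [2 e] per unit length for each pair of opposite sides. *)
Lemma circulation_bound (P Q : R -> R -> R) (a b c d x y px r qy e : R) :
  a <= x <= b -> c <= y <= d -> closed_form_on P Q a b c d ->
  (forall u v, a <= u <= b -> c <= v <= d ->
    Rabs (P u v - P x y - (px * (u - x) + r * (v - y))) <= e /\
    Rabs (Q u v - Q x y - (r * (u - x) + qy * (v - y))) <= e) ->
  Rabs (circulation P Q a b c d) <= 2 * e * ((b - a) + (d - c)).
Proof.
  intros Hx Hy HC H.
  assert (exP : forall v, c <= v <= d -> ex_RInt (fun u => P u v) a b)
    by (intros; eapply closed_form_ex_RInt_fst; try eassumption; lra).
  assert (exQ : forall u, a <= u <= b -> ex_RInt (fun v => Q u v) c d)
    by (intros; eapply closed_form_ex_RInt_snd; try eassumption; lra).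
  (* Opposite sides are paired and the increment [r (b - a)] or [r (d - c)] of the affine part is
     removed; after integration both corrections equal [r (b - a) (d - c)] and cancel. *)
  set (f := fun v => (Q b v - Q a v) - r * (b - a)).
  set (g := fun u => (P u d - P u c) - r * (d - c)).
  assert (I1 : is_RInt f c d ((RInt (fun v => Q b v) c d - RInt (fun v => Q a v) c d) - (d - c) * (r * (b - a)))).
  { apply (is_RInt_minus (V := R_NormedModule)).
    apply (is_RInt_minus (V := R_NormedModule)); apply (RInt_correct (V := R_CompleteNormedModule)), exQ; lra.
    apply (is_RInt_const (V := R_NormedModule)). }
  assert (I2 : is_RInt g a b ((RInt (fun u => P u d) a b - RInt (fun u => P u c) a b) - (b - a) * (r * (d - c)))).
  { apply (is_RInt_minus (V := R_NormedModule)).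
    apply (is_RInt_minus (V := R_NormedModule)); apply (RInt_correct (V := R_CompleteNormedModule)), exP; lra.
    apply (is_RInt_const (V := R_NormedModule)). }
  assert (B1 : Rabs (RInt f c d) <= (d - c) * (2 * e)).
  { apply abs_RInt_le_const. lra. now exists (RInt (fun v => Q b v) c d - RInt (fun v => Q a v) c d - (d - c) * (r * (b - a))).
    intros v Hv. unfold f.
    destruct (H b v ltac:(lra) Hv) as [_ Hb]. destruct (H a v ltac:(lra) Hv) as [_ Ha].
    apply Rabs_le_between in Ha. apply Rabs_le_between in Hb.
    apply Rabs_le_between. lra. }
  assert (B2 : Rabs (RInt g a b) <= (b - a) * (2 * e)).
  { apply abs_RInt_le_const. lra. eexists; exact I2.
    intros u Hu. unfold g.
    destruct (H u d Hu ltac:(lra)) as [Hb _]. destruct (H u c Hu ltac:(lra)) as [Ha _].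
    apply Rabs_le_between in Ha. apply Rabs_le_between in Hb.
    apply Rabs_le_between. lra. }
  rewrite (is_RInt_unique (V := R_CompleteNormedModule) _ _ _ _ I1) in B1.
  rewrite (is_RInt_unique (V := R_CompleteNormedModule) _ _ _ _ I2) in B2.
  unfold circulation.
  apply Rabs_le_between in B1. apply Rabs_le_between in B2. apply Rabs_le_between.
  lra.
Qed.

(* Goursat's bisection, which needs no continuity of the partial derivatives. *)
Lemma circulation_zero (P Q : R -> R -> R) (a b c d : R) :
  a < b -> c < d -> closed_form_on P Q a b c d -> circulation P Q a b c d = 0.
Proof.
  intros Hab Hcd HC.
  destruct (Req_dec (circulation P Q a b c d) 0) as [|Hne]; [assumption|exfalso].
  set (A := b - a). set (B := d - c).
  set (k := Rabs (circulation P Q a b c d)).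
  assert (Hk : 0 < k) by now apply Rabs_pos_lt.
  assert (hA : 0 < A) by (unfold A; lra). assert (hB : 0 < B) by (unfold B; lra).
  assert (w0 : forall X n, 0 < X -> 0 < X / 2 ^ n)
    by (intros; apply Rdiv_lt_0_compat; [assumption|apply pow_lt; lra]).
  assert (wS : forall X n, X / 2 ^ n = X / 2 ^ S n + X / 2 ^ S n).
  { intros X n. simpl. field. apply pow_nonzero. lra. }
  (* A state is the lower left corner of the current rectangle, whose sides are [A / 2^n] and
     [B / 2^n]. By the triangle inequality one of its four quarters keeps at least a quarter of the
     circulation. *)
  pose (Inv := fun n (p : R * R) =>
    a <= fst p /\ fst p + A / 2 ^ n <= b /\ c <= snd p /\ snd p + B / 2 ^ n <= d /\
    k / 4 ^ n <= Rabs (circulation P Q (fst p) (fst p + A / 2 ^ n) (snd p) (snd p + B / 2 ^ n))).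
  pose (step := fun n (p p' : R * R) =>
    (fst p <= fst p' /\ fst p' + A / 2 ^ S n <= fst p + A / 2 ^ n) /\
    (snd p <= snd p' /\ snd p' + B / 2 ^ S n <= snd p + B / 2 ^ n)).
  destruct (dependent_choice (R * R) Inv step (a, c)) as (s & _ & Hs).
  { unfold Inv; simpl. unfold Rdiv. rewrite Rinv_1, !Rmult_1_r. unfold A, B.
    replace (a + (b - a)) with b by ring. replace (c + (d - c)) with d by ring.
    fold k. lra. }
  { intros n [x y] (H1 & H2 & H3 & H4 & H5). cbn [fst snd] in H1, H2, H3, H4, H5.
    set (u := A / 2 ^ S n). set (v := B / 2 ^ S n).
    assert (hu : 0 < u) by now apply w0. assert (hv : 0 < v) by now apply w0.
    assert (eu : A / 2 ^ n = u + u) by apply wS.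
    assert (ev : B / 2 ^ n = v + v) by apply wS.
    assert (H5' : k / 4 ^ S n * 4 <= Rabs (circulation P Q x (x + A / 2 ^ n) y (y + B / 2 ^ n))).
    { eapply Rle_trans; [|exact H5]. right. simpl. field. apply pow_nonzero. lra. }
    rewrite (circulation_split P Q x (x + u) (x + A / 2 ^ n) y (y + v) (y + B / 2 ^ n)) in H5'
      by (try (apply closed_form_on_sub with a b c d; assumption); lra).
    rewrite eu, ev in *.
    replace (x + (u + u)) with (x + u + u) in * by ring.
    replace (y + (v + v)) with (y + v + v) in * by ring.
    set (J1 := circulation P Q x (x + u) y (y + v)) in *.
    set (J2 := circulation P Q (x + u) (x + u + u) y (y + v)) in *.
    set (J3 := circulation P Q x (x + u) (y + v) (y + v + v)) in *.
    set (J4 := circulation P Q (x + u) (x + u + u) (y + v) (y + v + v)) in *.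
    assert (T : Rabs (J1 + J2 + J3 + J4) <= Rabs J1 + Rabs J2 + Rabs J3 + Rabs J4).
    { pose proof (Rabs_triang (J1 + J2 + J3) J4). pose proof (Rabs_triang (J1 + J2) J3).
      pose proof (Rabs_triang J1 J2). lra. }
    unfold Inv, step; cbn [fst snd]; rewrite eu, ev; fold u v.
    destruct (Rle_dec (k / 4 ^ S n) (Rabs J1)) as [h1|h1].
    { exists (x, y); cbn [fst snd]; repeat split; lra || exact h1. }
    destruct (Rle_dec (k / 4 ^ S n) (Rabs J2)) as [h2|h2].
    { exists (x + u, y); cbn [fst snd]; repeat split; lra || exact h2. }
    destruct (Rle_dec (k / 4 ^ S n) (Rabs J3)) as [h3|h3].
    { exists (x, y + v); cbn [fst snd]; repeat split; lra || exact h3. }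
    exists (x + u, y + v); cbn [fst snd]; repeat split; fold J4; lra. }
  destruct (nested_halving (fun n => fst (s n)) A) as [x Hx]; [lra|apply Hs|].
  destruct (nested_halving (fun n => snd (s n)) B) as [y Hy]; [lra|apply Hs|].
  assert (Hxy : a <= x <= b /\ c <= y <= d).
  { pose proof (Hx 0%nat). pose proof (Hy 0%nat).
    destruct (Hs 0%nat) as [(H1 & H2 & H3 & H4 & _) _]. lra. }
  destruct (HC x y (proj1 Hxy) (proj2 Hxy)) as (px & r & qy & DP & DQ).
  (* With deviation [e (u + v)] on a rectangle of sides [u = A / 2^n] and [v = B / 2^n], the bound
     [2 e (u + v)^2] equals [k / 4^n / 2], half of what the invariant demands. *)
  set (e := k / (4 * (A + B) * (A + B))).
  assert (he : 0 < e).
  { apply Rdiv_lt_0_compat; [assumption|]. repeat apply Rmult_lt_0_compat; lra. }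
  destruct (DP (mkposreal e he)) as [d1 D1]. destruct (DQ (mkposreal e he)) as [d2 D2].
  cbn [pos] in D1, D2.
  set (dl := Rmin d1 d2).
  assert (hd : 0 < dl) by (apply Rmin_glb_lt; apply cond_pos).
  destruct (pow_lt_1_zero (/ 2) ltac:(rewrite Rabs_pos_eq; lra) (dl / (A + B))
    ltac:(apply Rdiv_lt_0_compat; lra)) as [n Hn].
  specialize (Hn n (le_n n)).
  rewrite Rabs_pos_eq in Hn by (apply pow_le; lra).
  rewrite pow_inv in Hn.
  assert (p2 : 0 < 2 ^ n) by (apply pow_lt; lra).
  assert (Hn' : A / 2 ^ n + B / 2 ^ n < dl).
  { replace (A / 2 ^ n + B / 2 ^ n) with ((A + B) * / 2 ^ n) by (field; lra).
    apply Rlt_le_trans with ((A + B) * (dl / (A + B))).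
    apply Rmult_lt_compat_l; lra. right; field; lra. }
  destruct (Hs n) as [(H1 & H2 & H3 & H4 & H5) _].
  specialize (Hx n). specialize (Hy n). simpl in Hx, Hy.
  set (u := A / 2 ^ n) in *. set (v := B / 2 ^ n) in *.
  assert (hu : 0 < u) by now apply w0. assert (hv : 0 < v) by now apply w0.
  assert (L1 := Rmin_l d1 d2). assert (L2 := Rmin_r d1 d2). fold dl in L1, L2.
  assert (Bd : Rabs (circulation P Q (fst (s n)) (fst (s n) + u) (snd (s n)) (snd (s n) + v))
    <= 2 * (e * (u + v)) * ((fst (s n) + u - fst (s n)) + (snd (s n) + v - snd (s n)))).
  { apply circulation_bound with x y px r qy; try lra.
    - apply closed_form_on_sub with a b c d; lra || assumption.
    - intros x' y' Hx' Hy'.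
      assert (Bx : Rabs (x' - x) <= u) by (apply Rabs_le_between; lra).
      assert (By : Rabs (y' - y) <= v) by (apply Rabs_le_between; lra).
      assert (Rmax (Rabs (x' - x)) (Rabs (y' - y)) <= u + v) by (apply Rmax_lub; lra).
      split; (eapply Rle_trans; [apply D1 || apply D2; lra|]); apply Rmult_le_compat_l; lra. }
  assert (E : 2 * (e * (u + v)) * ((fst (s n) + u - fst (s n)) + (snd (s n) + v - snd (s n))) = k / 4 ^ n / 2).
  { replace (4 ^ n) with (2 ^ n * 2 ^ n) by (rewrite <- Rpow_mult_distr; f_equal; lra).
    unfold e, u, v. field. repeat split; lra. }
  assert (0 < k / 4 ^ n) by (apply Rdiv_lt_0_compat; [assumption|apply pow_lt; lra]).
  lra.
Qed.

Open Scope C_scope.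

(** * Means on circles *)

Lemma Re_Cmult (a b : C) : Re (a * b) = (Re a * Re b - Im a * Im b)%R.
Proof. reflexivity. Qed.

Lemma Im_Cmult (a b : C) : Im (a * b) = (Re a * Im b + Im a * Re b)%R.
Proof. reflexivity. Qed.

(** The Cauchy-Riemann equations: [Re l] is both the y-derivative of [Im f] and the x-derivative of
    [Re f], which makes the form [Im f dx + Re f dy] closed. *)
Lemma is_Cderive_differentiable (f : C -> C) (x y : R) (l : C) :
  is_Cderive f (x, y) l ->
  differentiable_pt_lim (fun u v => Re (f (u, v))) x y (Re l) (- Im l) /\
  differentiable_pt_lim (fun u v => Im (f (u, v))) x y (Im l) (Re l).
Proof.
  intros H. rewrite is_Cderive_eps in H.
  enough (K : forall eps : posreal, exists d : posreal, forall u v : R,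
    (Rabs (u - x) < d -> Rabs (v - y) < d ->
     Cmod (f (u, v) - f (x, y) - l * (u - x, v - y)%R) <= eps * Rmax (Rabs (u - x)) (Rabs (v - y)))%R).
  { split; intros eps; destruct (K eps) as [d Hd]; exists d; intros u v Hu Hv;
      (eapply Rle_trans; [|exact (Hd u v Hu Hv)]).
    - eapply Rle_trans; [|apply re_le_Cmod]. right. f_equal.
      unfold Cminus, Cmult; simpl. unfold Re, Im. ring.
    - eapply Rle_trans; [|apply Im_le_Cmod]. right. f_equal.
      unfold Cminus, Cmult; simpl. unfold Re, Im. ring. }
  intros eps. destruct (H (eps / 2)%R) as (d & Hd & Hy).
  { pose proof (cond_pos eps). lra. }
  exists (mkposreal (d / 2) ltac:(lra)). simpl. intros u v Hu Hv.
  assert (E : (u, v) - (x, y) = ((u - x)%R, (v - y)%R)) by reflexivity.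
  assert (B := Cmod_le_abs (u - x) (v - y)).
  assert (B1 := Rmax_l (Rabs (u - x)) (Rabs (v - y))).
  assert (B2 := Rmax_r (Rabs (u - x)) (Rabs (v - y))).
  specialize (Hy (u, v)). rewrite E in Hy. specialize (Hy ltac:(lra)).
  eapply Rle_trans. apply Hy.
  pose proof (cond_pos eps).
  replace (eps * Rmax (Rabs (u - x)) (Rabs (v - y)))%R
    with (eps / 2 * (2 * Rmax (Rabs (u - x)) (Rabs (v - y))))%R by field.
  apply Rmult_le_compat_l; lra.
Qed.

(** The point 0 is left out because quotients by powers of [z] take a default value there. *)
Definition punctured_holomorphic (f : C -> C) : Prop :=
  forall z, in_disc z -> z <> 0 -> exists l, is_Cderive f z l.

(** The order of vanishing at 0, tested on a punctured neighbourhood for the same reason. With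
    [n = 0] it is boundedness near 0, the substitute for a removable singularity. *)
Definition bigO (n : nat) (g : C -> C) : Prop :=
  exists M d : R, (0 <= M /\ 0 < d /\
    forall z : C, z <> 0 -> Cmod z < d -> Cmod (g z) <= M * Cmod z ^ n)%R.

Lemma punctured_holomorphic_const (c : C) : punctured_holomorphic (fun _ => c).
Proof. intros z _ _. exists 0. apply is_Cderive_const. Qed.

Lemma punctured_holomorphic_id : punctured_holomorphic (fun z => z).
Proof. intros z _ _. exists 1. apply is_Cderive_id. Qed.

Lemma punctured_holomorphic_inv : punctured_holomorphic (fun z => / z).
Proof. intros z _ Hz. eexists. now apply is_Cderive_inv. Qed.

Lemma punctured_holomorphic_plus (f g : C -> C) :
  punctured_holomorphic f -> punctured_holomorphic g ->
  punctured_holomorphic (fun z => f z + g z).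
Proof.
  intros Hf Hg z Dz Nz. destruct (Hf z Dz Nz), (Hg z Dz Nz).
  eexists. apply is_Cderive_plus; eassumption.
Qed.

Lemma punctured_holomorphic_minus (f g : C -> C) :
  punctured_holomorphic f -> punctured_holomorphic g ->
  punctured_holomorphic (fun z => f z - g z).
Proof.
  intros Hf Hg z Dz Nz. destruct (Hf z Dz Nz), (Hg z Dz Nz).
  eexists. apply is_Cderive_minus; eassumption.
Qed.

Lemma punctured_holomorphic_mult (f g : C -> C) :
  punctured_holomorphic f -> punctured_holomorphic g ->
  punctured_holomorphic (fun z => f z * g z).
Proof.
  intros Hf Hg z Dz Nz. destruct (Hf z Dz Nz), (Hg z Dz Nz).
  eexists. apply is_Cderive_mult; eassumption.
Qed.

Create HintDb holo.
#[export] Hint Resolve punctured_holomorphic_const punctured_holomorphic_id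
  punctured_holomorphic_inv punctured_holomorphic_plus punctured_holomorphic_minus
  punctured_holomorphic_mult : holo.

Lemma bigO_const (c : C) : bigO 0 (fun _ => c).
Proof.
  exists (Cmod c), 1%R. split. apply Cmod_ge_0. split. lra.
  intros z _ _. simpl. lra.
Qed.

Lemma bigO_id : bigO 1 (fun z => z).
Proof. exists 1%R, 1%R. split. lra. split. lra. intros z _ _. simpl. lra. Qed.

Lemma bigO_weaken (m n : nat) (g : C -> C) : (m <= n)%nat -> bigO n g -> bigO m g.
Proof.
  intros Hmn (M & d & HM & Hd & H). exists M, (Rmin d 1). split. assumption.
  split. apply Rmin_glb_lt; lra.
  intros z Nz Hz. eapply Rle_trans. apply H; [assumption|].
  eapply Rlt_le_trans. apply Hz. apply Rmin_l.
  apply Rmult_le_compat_l. assumption.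
  assert (Cmod z < 1)%R by (eapply Rlt_le_trans; [apply Hz|apply Rmin_r]).
  pose proof (Cmod_ge_0 z).
  replace n with (m + (n - m))%nat by lia. rewrite pow_add.
  pose proof (pow_le (Cmod z) m H1).
  assert (Cmod z ^ (n - m) <= 1)%R.
  { rewrite <- (pow1 (n - m)). apply pow_incr. lra. }
  nra.
Qed.

Lemma bigO_plus (n : nat) (f g : C -> C) :
  bigO n f -> bigO n g -> bigO n (fun z => f z + g z).
Proof.
  intros (M & d & HM & Hd & H) (M' & d' & HM' & Hd' & H').
  exists (M + M')%R, (Rmin d d'). split. lra. split. apply Rmin_glb_lt; lra.
  intros z Nz Hz. eapply Rle_trans. apply Cmod_triangle.
  assert (H1 := H z Nz (Rlt_le_trans _ _ _ Hz (Rmin_l _ _))).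
  assert (H2 := H' z Nz (Rlt_le_trans _ _ _ Hz (Rmin_r _ _))). lra.
Qed.

Lemma bigO_mult (m n : nat) (f g : C -> C) :
  bigO m f -> bigO n g -> bigO (m + n) (fun z => f z * g z).
Proof.
  intros (M & d & HM & Hd & H) (M' & d' & HM' & Hd' & H').
  exists (M * M')%R, (Rmin d d'). split. now apply Rmult_le_pos. split. apply Rmin_glb_lt; lra.
  intros z Nz Hz.
  assert (H1 := H z Nz (Rlt_le_trans _ _ _ Hz (Rmin_l _ _))).
  assert (H2 := H' z Nz (Rlt_le_trans _ _ _ Hz (Rmin_r _ _))).
  rewrite Cmod_mult, pow_add.
  replace (M * M' * (Cmod z ^ m * Cmod z ^ n))%R with ((M * Cmod z ^ m) * (M' * Cmod z ^ n))%R by ring.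
  apply Rmult_le_compat; try apply Cmod_ge_0; assumption.
Qed.

Lemma bigO_opp (n : nat) (f : C -> C) : bigO n f -> bigO n (fun z => - f z).
Proof.
  intros (M & d & HM & Hd & H). exists M, d. repeat split; try assumption.
  intros z. rewrite Cmod_opp. apply H.
Qed.

Lemma bigO_minus (n : nat) (f g : C -> C) :
  bigO n f -> bigO n g -> bigO n (fun z => f z - g z).
Proof. intros Hf Hg. exact (bigO_plus n f _ Hf (bigO_opp n g Hg)). Qed.

Lemma bigO_ext (n : nat) (f g : C -> C) (r : R) :
  (0 < r)%R -> (forall z : C, z <> 0 -> (Cmod z < r)%R -> f z = g z) -> bigO n f -> bigO n g.
Proof.
  intros Hr E (M & d & HM & Hd & H). exists M, (Rmin d r).
  split. assumption. split. apply Rmin_glb_lt; lra.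
  intros z Nz Hz. rewrite <- (E z Nz).
  { apply H; [assumption|]. exact (Rlt_le_trans _ _ _ Hz (Rmin_l _ _)). }
  exact (Rlt_le_trans _ _ _ Hz (Rmin_r _ _)).
Qed.

Lemma bigO_div_pow (m n : nat) (f : C -> C) :
  bigO (m + n) f -> bigO m (fun z => f z / z ^ n).
Proof.
  intros (M & d & HM & Hd & H). exists M, d. repeat split; try assumption.
  intros z Nz Hz. rewrite Cmod_div by now apply Cpow_nz. rewrite Cmod_pow.
  assert (0 < Cmod z ^ n)%R by (apply pow_lt; now apply Cmod_gt_0).
  apply Rmult_le_reg_r with (Cmod z ^ n)%R. assumption.
  unfold Rdiv. rewrite (Rmult_assoc (Cmod (f z))), Rinv_l by lra.
  rewrite Rmult_1_r, Rmult_assoc, <- pow_add. now apply H.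
Qed.

Lemma bigO_0_plus (f g : C -> C) : bigO 0 f -> bigO 0 g -> bigO 0 (fun z => f z + g z).
Proof. apply bigO_plus. Qed.

Lemma bigO_0_mult (f g : C -> C) : bigO 0 f -> bigO 0 g -> bigO 0 (fun z => f z * g z).
Proof. apply (bigO_mult 0 0). Qed.

Lemma bigO_0_id : bigO 0 (fun z => z).
Proof. apply (bigO_weaken 0 1); [lia|apply bigO_id]. Qed.

Create HintDb bdd.
#[export] Hint Resolve bigO_const bigO_0_id bigO_0_plus bigO_0_mult bigO_minus : bdd.

Lemma Cexp_neq_0 (z : C) : Cexp z <> 0.
Proof. apply Cmod_gt_0. rewrite Cmod_Cexp. apply exp_pos. Qed.

Lemma Cexp_in_disc (s t : R) : (s < 0)%R -> in_disc (Cexp (s, t)).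
Proof.
  intros Hs. unfold in_disc. rewrite Cmod_Cexp. simpl. rewrite <- exp_0.
  now apply exp_increasing.
Qed.

Lemma is_Cderive_circle (K : C -> C) (s t : R) :
  punctured_holomorphic K -> (s < 0)%R ->
  exists l, is_Cderive (fun z => K (Cexp z)) (s, t) l.
Proof.
  intros H Hs. destruct (H (Cexp (s, t)) (Cexp_in_disc s t Hs) (Cexp_neq_0 _)) as [l Hl].
  eexists. apply is_Cderive_comp. exact Hl. apply is_Cderive_exp.
Qed.

(** The function [K (Cexp (s, t))] has period [2 * PI] in [t], so the horizontal sides of a
    rectangle cancel and the mean is the same for all [s]. As [s] decreases the circle shrinks, and
    the bound [O(z)] forces the common value to be 0. *)
Lemma mean_zero (K : C -> C) (s : R) :
  punctured_holomorphic K -> bigO 1 K -> (s < 0)%R ->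
  (RInt (fun t => Re (K (Cexp (s, t)))) 0 (2 * PI) = 0)%R.
Proof.
  intros HK (M & d & HM & Hd & HB) Hs.
  pose proof PI_RGT_0 as Hpi.
  (* The form is the imaginary part of [F dz], with [F] the composite of [K] and [Cexp]; its
     vertical sides carry the integrals of [Re F]. *)
  assert (Hcl : forall s1, (s1 < s)%R -> closed_form_on (fun x y => Im (K (Cexp (x, y))))
     (fun x y => Re (K (Cexp (x, y)))) s1 s 0 (2 * PI)).
  { intros s1 H1 x y Hx Hy.
    destruct (is_Cderive_circle K x y HK ltac:(lra)) as [l Hl].
    destruct (is_Cderive_differentiable _ _ _ _ Hl) as [D1 D2].
    exists (Im l), (Re l), (- Im l)%R. split; assumption. }
  set (I := fun s => RInt (fun t => Re (K (Cexp (s, t)))) 0 (2 * PI)).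
  assert (HI : forall s1, (s1 < s)%R -> I s1 = I s).
  { intros s1 H1.
    assert (C0 := circulation_zero _ _ s1 s 0 (2 * PI) H1 ltac:(lra) (Hcl s1 H1)).
    unfold circulation in C0. fold (I s) (I s1) in C0.
    replace (RInt (fun x => Im (K (Cexp (x, (2 * PI)%R)))) s1 s)
      with (RInt (fun x => Im (K (Cexp (x, 0%R)))) s1 s) in C0.
    - unfold I in *. lra.
    - apply RInt_ext. intros x _. f_equal. f_equal. unfold Cexp. simpl.
      rewrite cos_2PI, sin_2PI, cos_0, sin_0. reflexivity. }
  change (I s = 0%R).
  destruct (Req_dec (I s) 0) as [|Hne]; [assumption|exfalso].
  assert (Hp : (0 < Rabs (I s))%R) by now apply Rabs_pos_lt.
  (* On a circle of radius at most [e] the integral is at most [2 * PI * M * e], hence at most half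
     of [Rabs (I s)], a contradiction. Using [M + 1] avoids a zero denominator. *)
  set (e := Rmin (d / 2) (Rabs (I s) / (4 * PI * (M + 1)))).
  assert (he : (0 < e)%R).
  { apply Rmin_glb_lt. lra. apply Rdiv_lt_0_compat. assumption. nra. }
  set (s1 := Rmin (s - 1) (ln e)).
  assert (Hs1 : (s1 < s)%R) by (pose proof (Rmin_l (s - 1) (ln e)); unfold s1; lra).
  assert (Hse : (exp s1 <= e)%R).
  { rewrite <- (exp_ln e he). destruct (Rmin_r (s - 1) (ln e)) as [h|h].
    left. now apply exp_increasing. unfold s1. rewrite h. lra. }
  assert (B : (Rabs (I s1) <= (2 * PI - 0) * (M * e))%R).
  { apply abs_RInt_le_const. lra.
    - apply (ex_RInt_continuous (V := R_CompleteNormedModule)). intros t _.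
      destruct (is_Cderive_circle K s1 t HK ltac:(lra)) as [l Hl].
      destruct (is_Cderive_differentiable _ _ _ _ Hl) as [D1 _].
      exact (differentiable_continuous_snd _ _ _ _ _ D1).
    - intros t _. eapply Rle_trans. apply re_le_Cmod.
      assert (L := Rmin_l (d / 2) (Rabs (I s) / (4 * PI * (M + 1)))). fold e in L.
      eapply Rle_trans. apply HB. apply Cexp_neq_0. rewrite Cmod_Cexp. simpl. lra.
      rewrite Cmod_Cexp. simpl. rewrite Rmult_1_r. now apply Rmult_le_compat_l. }
  rewrite HI in B by assumption.
  assert (L := Rmin_r (d / 2) (Rabs (I s) / (4 * PI * (M + 1)))). fold e in L.
  assert ((2 * PI - 0) * (M * e) <= Rabs (I s) / 2)%R.
  { apply Rle_trans with (2 * PI * ((M + 1) * (Rabs (I s) / (4 * PI * (M + 1)))))%R.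
    - rewrite Rminus_0_r. apply Rmult_le_compat_l. lra. apply Rmult_le_compat; lra.
    - right. field. split; lra. }
  lra.
Qed.

(** Taken on the circle of radius [exp s], without dividing by [2 * PI]. *)
Definition mean_square (H : C -> C) (s : R) : R :=
  RInt (fun t => (Cmod (H (Cexp (s, t))) ^ 2)%R) 0 (2 * PI).

Lemma continuous_circle_Re (K : C -> C) (s t : R) :
  punctured_holomorphic K -> (s < 0)%R ->
  continuous (fun t => Re (K (Cexp (s, t)))) t.
Proof.
  intros HK Hs. destruct (is_Cderive_circle K s t HK Hs) as [l Hl].
  destruct (is_Cderive_differentiable _ _ _ _ Hl) as [D _].
  exact (differentiable_continuous_snd _ _ _ _ _ D).
Qed.

Lemma continuous_circle_sqr (K : C -> C) (s t : R) :
  punctured_holomorphic K -> (s < 0)%R ->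
  continuous (fun t => (Cmod (K (Cexp (s, t))) ^ 2)%R) t.
Proof.
  intros HK Hs. destruct (is_Cderive_circle K s t HK Hs) as [l Hl].
  destruct (is_Cderive_differentiable _ _ _ _ Hl) as [D1 D2].
  apply differentiable_continuous_snd in D1. apply differentiable_continuous_snd in D2.
  apply (continuous_ext (fun t => plus
     (mult (Re (K (Cexp (s, t)))) (Re (K (Cexp (s, t)))))
     (mult (Im (K (Cexp (s, t)))) (Im (K (Cexp (s, t))))))%R).
  { intros u. rewrite Cmod2_alt. unfold plus, mult; simpl. ring. }
  apply (continuous_plus (V := R_NormedModule)); apply (continuous_mult (K := R_AbsRing)); assumption.
Qed.

Lemma ex_RInt_circle_sqr (K : C -> C) (s a b : R) :
  punctured_holomorphic K -> (s < 0)%R ->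
  ex_RInt (fun t => (Cmod (K (Cexp (s, t))) ^ 2)%R) a b.
Proof.
  intros HK Hs. apply (ex_RInt_continuous (V := R_CompleteNormedModule)).
  intros t _. now apply continuous_circle_sqr.
Qed.

Lemma mean_square_ge_0 (H : C -> C) (s : R) :
  punctured_holomorphic H -> (s < 0)%R -> (0 <= mean_square H s)%R.
Proof.
  intros HH Hs. apply RInt_ge_0. pose proof PI_RGT_0; lra.
  now apply ex_RInt_circle_sqr. intros. apply pow2_ge_0.
Qed.

(* Parseval's identity, one Taylor coefficient at a time. *)
Lemma mean_square_peel (H G : C -> C) (x : C) (s : R) :
  punctured_holomorphic G -> bigO 0 G -> (s < 0)%R ->
  (forall z, in_disc z -> z <> 0 -> H z = x + z * G z) ->
  mean_square H s = (2 * PI * Cmod x ^ 2 + exp s ^ 2 * mean_square G s)%R.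
Proof.
  intros HG BG Hs E.
  (* Half of the cross term of [|x + z G|^2] is the real part of [K]; it is [O(z)], so its mean
     vanishes. *)
  set (K := fun z => Cconj x * (z * G z)).
  assert (HK : punctured_holomorphic K) by (unfold K; auto with holo).
  assert (BK : bigO 1 K).
  { apply (bigO_mult 0 1). apply bigO_const. apply (bigO_mult 1 0). apply bigO_id. assumption. }
  assert (Z := mean_zero K s HK BK Hs).
  assert (I : is_RInt (fun t => plus (plus (Cmod x ^ 2)%R (scal 2%R (Re (K (Cexp (s, t))))))
      (scal (exp s ^ 2)%R (Cmod (G (Cexp (s, t))) ^ 2)%R)) 0 (2 * PI)
      (plus (plus (scal (2 * PI - 0)%R (Cmod x ^ 2)%R) (scal 2%R 0%R)) (scal (exp s ^ 2)%R (mean_square G s)))).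
  { apply (is_RInt_plus (V := R_NormedModule)). apply (is_RInt_plus (V := R_NormedModule)).
    - apply (is_RInt_const (V := R_NormedModule)).
    - apply (is_RInt_scal (V := R_NormedModule)).
      assert (I0 : ex_RInt (fun t => Re (K (Cexp (s, t)))) 0 (2 * PI)).
      { apply (ex_RInt_continuous (V := R_CompleteNormedModule)).
        intros t _. now apply continuous_circle_Re. }
      apply (RInt_correct (V := R_CompleteNormedModule)) in I0. rewrite Z in I0. exact I0.
    - apply (is_RInt_scal (V := R_NormedModule)). apply (RInt_correct (V := R_CompleteNormedModule)).
      now apply ex_RInt_circle_sqr. }
  apply (is_RInt_unique (V := R_CompleteNormedModule)) in I.
  transitivity (plus (plus (scal (2 * PI - 0)%R (Cmod x ^ 2)%R) (scal 2%R 0%R)) (scal (exp s ^ 2)%R (mean_square G s))).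
  - rewrite <- I. apply RInt_ext. intros t _.
    rewrite E by (apply Cexp_in_disc || apply Cexp_neq_0; assumption).
    change (Cmod (x + Cexp (s, t) * G (Cexp (s, t))) ^ 2 = Cmod x ^ 2 + 2 * Re (K (Cexp (s, t)))
      + exp s ^ 2 * Cmod (G (Cexp (s, t))) ^ 2)%R.
    assert (Ez : (exp s ^ 2 = Re (Cexp (s, t)) ^ 2 + Im (Cexp (s, t)) ^ 2)%R).
    { rewrite <- Cmod2_alt, Cmod_Cexp. reflexivity. }
    rewrite Ez. unfold K. set (z := Cexp (s, t)). set (g := G z).
    rewrite !Cmod2_alt.
    destruct x as [x1 x2], z as [z1 z2], g as [g1 g2]. unfold Re, Im; simpl. ring.
  - unfold plus, scal; simpl. unfold mult; simpl. ring.
Qed.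

(** Bessel's inequality. Peeling off the coefficients 0, [b1], ..., [b4] gives each [|b_k|^2] the
    weight [exp s ^ (2 k)], which is at least [exp s ^ 8], and leaves a nonnegative remainder. *)
Lemma mean_square_taylor4_ge (H : C -> C) (b1 b2 b3 b4 : C) (s : R) :
  punctured_holomorphic H -> (s < 0)%R ->
  bigO 5 (fun z => H z - z * (b1 + z * (b2 + z * (b3 + z * b4)))) ->
  (2 * PI * (exp s ^ 8 * (Cmod b1 ^ 2 + Cmod b2 ^ 2 + Cmod b3 ^ 2 + Cmod b4 ^ 2))
    <= mean_square H s)%R.
Proof.
  intros HH Hs HO.
  (* The remainder quotient is bounded near 0 and holomorphic off 0, which is all that the peeling
     asks of it. *)
  set (G5 := fun z => (H z - z * (b1 + z * (b2 + z * (b3 + z * b4)))) / z ^ 5).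
  assert (B5 : bigO 0 G5) by now apply (bigO_div_pow 0 5).
  assert (H5 : punctured_holomorphic G5).
  { unfold G5, Cdiv. apply punctured_holomorphic_mult. auto 20 with holo.
    intros z Dz Nz. eexists. apply (is_Cderive_comp Cinv (fun z => z ^ 5)).
    apply is_Cderive_inv. now apply Cpow_nz. apply is_Cderive_pow. }
  set (G4 := fun z => b4 + z * G5 z). set (G3 := fun z => b3 + z * G4 z).
  set (G2 := fun z => b2 + z * G3 z). set (G1 := fun z => b1 + z * G2 z).
  assert (B4 : bigO 0 G4) by (unfold G4; auto with bdd).
  assert (B3 : bigO 0 G3) by (unfold G3; auto with bdd).
  assert (B2 : bigO 0 G2) by (unfold G2; auto with bdd).
  assert (B1 : bigO 0 G1) by (unfold G1; auto with bdd).
  assert (H4 : punctured_holomorphic G4) by (unfold G4; auto with holo).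
  assert (H3 : punctured_holomorphic G3) by (unfold G3; auto with holo).
  assert (H2 : punctured_holomorphic G2) by (unfold G2; auto with holo).
  assert (H1 : punctured_holomorphic G1) by (unfold G1; auto with holo).
  rewrite (mean_square_peel H G1 0 s H1 B1 Hs).
  2: { intros z _ Nz. unfold G1, G2, G3, G4, G5. field. assumption. }
  rewrite (mean_square_peel G1 G2 b1 s H2 B2 Hs ltac:(reflexivity)).
  rewrite (mean_square_peel G2 G3 b2 s H3 B3 Hs ltac:(reflexivity)).
  rewrite (mean_square_peel G3 G4 b3 s H4 B4 Hs ltac:(reflexivity)).
  rewrite (mean_square_peel G4 G5 b4 s H5 B5 Hs ltac:(reflexivity)).
  pose proof (mean_square_ge_0 G5 s H5 Hs) as P5.
  pose proof PI_RGT_0 as Hpi.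
  pose proof (exp_pos s) as he. assert (he1 : (exp s < 1)%R) by (rewrite <- exp_0; now apply exp_increasing).
  rewrite Cmod_0. set (r := exp s) in *. set (m := mean_square G5 s) in *.
  pose proof (pow2_ge_0 (Cmod b1)). pose proof (pow2_ge_0 (Cmod b2)).
  pose proof (pow2_ge_0 (Cmod b3)). pose proof (pow2_ge_0 (Cmod b4)).
  assert (r2 : (0 < r ^ 2)%R) by nra.
  assert (r21 : (r ^ 2 < 1)%R) by nra.
  assert (r84 : (r ^ 8 = r ^ 2 * r ^ 2 * r ^ 2 * r ^ 2)%R) by ring. rewrite r84.
  set (q := (r ^ 2)%R) in *.
  assert (qq : (0 < q * q < q)%R) by nra. assert (qqq : (0 < q * q * q < q * q)%R) by nra.
  assert (q4 : (0 < q * q * q * q < q * q * q)%R) by nra.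
  assert (0 <= q * q * q * q * q * m)%R by (repeat apply Rmult_le_pos; lra).
  match goal with |- (?L <= ?R)%R => replace R with
   (2 * PI * (q * Cmod b1 ^ 2 + q * q * Cmod b2 ^ 2 + q * q * q * Cmod b3 ^ 2 + q * q * q * q * Cmod b4 ^ 2)
    + q * q * q * q * q * m)%R by ring end.
  apply Rle_trans with (2 * PI * (q * Cmod b1 ^ 2 + q * q * Cmod b2 ^ 2 + q * q * q * Cmod b3 ^ 2 + q * q * q * q * Cmod b4 ^ 2))%R; [|lra].
  apply Rmult_le_compat_l. lra.
  rewrite !Rmult_plus_distr_l.
  repeat apply Rplus_le_compat; apply Rmult_le_compat_r; lra.
Qed.

(** Parseval for a cubic; the weights [exp s ^ (2 k)] are now estimated from above by 1. *)
Lemma mean_square_poly3_le (x1 x2 x3 x4 : C) (s : R) :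
  (s < 0)%R ->
  (mean_square (fun z => x1 + z * (x2 + z * (x3 + z * x4)))%C s
   <= 2 * PI * (Cmod x1 ^ 2 + Cmod x2 ^ 2 + Cmod x3 ^ 2 + Cmod x4 ^ 2))%R.
Proof.
  intros Hs.
  rewrite (mean_square_peel _ (fun z => x2 + z * (x3 + z * x4)) x1 s);
    [|auto 20 with holo|auto 20 with bdd|assumption|reflexivity].
  rewrite (mean_square_peel _ (fun z => x3 + z * x4) x2 s);
    [|auto 20 with holo|auto 20 with bdd|assumption|reflexivity].
  rewrite (mean_square_peel _ (fun z => x4) x3 s);
    [|auto 20 with holo|auto 20 with bdd|assumption|reflexivity].
  rewrite (mean_square_peel (fun z => x4) (fun z => 0) x4 s);
    [|auto 20 with holo|auto 20 with bdd|assumption|intros; ring].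
  assert (E0 : mean_square (fun _ => 0) s = 0%R).
  { unfold mean_square. rewrite Cmod_0. rewrite (RInt_const (V := R_CompleteNormedModule)).
    unfold scal; simpl; unfold mult; simpl. ring. }
  rewrite E0.
  pose proof PI_RGT_0 as Hpi.
  pose proof (exp_pos s) as he. assert (he1 : (exp s < 1)%R) by (rewrite <- exp_0; now apply exp_increasing).
  set (r := exp s) in *.
  pose proof (pow2_ge_0 (Cmod x2)). pose proof (pow2_ge_0 (Cmod x3)). pose proof (pow2_ge_0 (Cmod x4)).
  assert (r2 : (0 < r ^ 2)%R) by nra.
  assert (r21 : (r ^ 2 < 1)%R) by nra.
  set (q := (r ^ 2)%R) in *.
  assert (qq : (0 < q * q < q)%R) by nra. assert (qqq : (0 < q * q * q < q * q)%R) by nra.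
  match goal with |- (?L <= ?R)%R => replace L with
   (2 * PI * (1 * Cmod x1 ^ 2 + q * Cmod x2 ^ 2 + q * q * Cmod x3 ^ 2 + q * q * q * Cmod x4 ^ 2))%R by ring end.
  apply Rmult_le_compat_l. lra.
  rewrite <- (Rmult_1_l (Cmod x1 ^ 2)%R) at 2. rewrite <- (Rmult_1_l (Cmod x2 ^ 2)%R) at 2.
  rewrite <- (Rmult_1_l (Cmod x3 ^ 2)%R) at 2. rewrite <- (Rmult_1_l (Cmod x4 ^ 2)%R) at 2.
  repeat apply Rplus_le_compat; apply Rmult_le_compat_r; try lra. apply pow2_ge_0.
Qed.

(** The left side lists the coefficients of [z], ..., [z^4] in [w * q], for the cubic [q] with
    coefficients [x1], ..., [x4]. Since [|w| <= 1], the lower bound for the mean square of [w * q]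
    and the upper bound for that of [q] combine to [exp s ^ 8 * S <= X], and [s] tends to 0. *)
Lemma toeplitz_contraction (w : C -> C) (c1 c2 c3 c4 x1 x2 x3 x4 : C) :
  punctured_holomorphic w ->
  (forall z, in_disc z -> (Cmod (w z) <= 1)%R) ->
  bigO 5 (fun z => w z - z * (c1 + z * (c2 + z * (c3 + z * c4)))) ->
  (Cmod (c1 * x1) ^ 2 + Cmod (c2 * x1 + c1 * x2) ^ 2
   + Cmod (c3 * x1 + c2 * x2 + c1 * x3) ^ 2
   + Cmod (c4 * x1 + c3 * x2 + c2 * x3 + c1 * x4) ^ 2
   <= Cmod x1 ^ 2 + Cmod x2 ^ 2 + Cmod x3 ^ 2 + Cmod x4 ^ 2)%R.
Proof.
  intros Hw Bw Ow.
  set (q := fun z => x1 + z * (x2 + z * (x3 + z * x4))).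
  assert (Hq : punctured_holomorphic q) by (unfold q; auto 20 with holo).
  assert (HF : punctured_holomorphic (fun z => w z * q z)) by auto with holo.
  set (S := (Cmod (c1 * x1) ^ 2 + Cmod (c2 * x1 + c1 * x2) ^ 2
   + Cmod (c3 * x1 + c2 * x2 + c1 * x3) ^ 2
   + Cmod (c4 * x1 + c3 * x2 + c2 * x3 + c1 * x4) ^ 2)%R).
  set (X := (Cmod x1 ^ 2 + Cmod x2 ^ 2 + Cmod x3 ^ 2 + Cmod x4 ^ 2)%R).
  pose proof PI_RGT_0 as Hpi.
  assert (Key : forall s, (s < 0)%R -> (exp s ^ 8 * S <= X)%R).
  { intros s Hs. apply Rmult_le_reg_l with (2 * PI)%R. lra.
    apply Rle_trans with (mean_square (fun z => w z * q z) s).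
    - apply mean_square_taylor4_ge; try assumption.
      (* The error of [w] times [q], plus the products of degree 5 to 7 that the truncation
         discards. *)
      apply (bigO_ext 5 (fun z => (w z - z * (c1 + z * (c2 + z * (c3 + z * c4)))) * q z
        + z ^ 5 * ((c4 * x2 + c3 * x3 + c2 * x4) + z * ((c4 * x3 + c3 * x4) + z * (c4 * x4)))) _ 1); [lra| |].
      { intros z _ _. unfold q. ring. }
      apply bigO_plus.
      + apply (bigO_mult 5 0). assumption. unfold q. auto 20 with bdd.
      + apply (bigO_mult 5 0).
        * exists 1%R, 1%R. split. lra. split. lra. intros z _ _. rewrite Cmod_pow. lra.
        * auto 20 with bdd.
    - apply Rle_trans with (mean_square q s).
      + apply RInt_le. lra. now apply (ex_RInt_circle_sqr (fun z => w z * q z)).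
        now apply ex_RInt_circle_sqr.
        intros t _. apply pow_incr. split. apply Cmod_ge_0. rewrite Cmod_mult.
        rewrite <- (Rmult_1_l (Cmod (q (Cexp (s, t))))) at 2.
        apply Rmult_le_compat_r. apply Cmod_ge_0. apply Bw. now apply Cexp_in_disc.
      + now apply mean_square_poly3_le. }
  destruct (Rle_dec S X) as [|Hn]; [assumption|exfalso].
  assert (HX : (0 <= X)%R) by (unfold X; repeat apply Rplus_le_le_0_compat; apply pow2_ge_0).
  (* If [S > X], the radius with [exp s ^ 8 = y] is contradictory, since
     [y * S = (X + S) / 2 > X]. *)
  set (y := ((X + S) / 2 / S)%R).
  assert (hS : (0 < S)%R) by lra.
  assert (hy : (0 < y < 1)%R).
  { split. apply Rdiv_lt_0_compat; lra. apply Rmult_lt_reg_r with S. lra. unfold y.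
    replace ((X + S) / 2 / S * S)%R with ((X + S) / 2)%R by (field; lra). lra. }
  specialize (Key (ln y / 8)%R).
  assert (ln y < 0)%R by (rewrite <- ln_1; apply ln_increasing; lra).
  specialize (Key ltac:(lra)).
  replace (exp (ln y / 8) ^ 8)%R with y in Key.
  - unfold y in Key. replace ((X + S) / 2 / S * S)%R with ((X + S) / 2)%R in Key by (field; lra). lra.
  - simpl. rewrite Rmult_1_r, <- !exp_plus.
    replace (ln y / 8 + _)%R with (ln y) by field. now rewrite exp_ln.
Qed.

(** * Complex power series *)

Definition is_Cseries (a : nat -> C) (l : C) : Prop :=
  is_series (K := C_AbsRing) (V := C_NormedModule) a l.

Definition Csum (a : nat -> C) (n : nat) : C := sum_n (G := C_NormedModule) a n.

Lemma Csum_0 (a : nat -> C) : Csum a 0 = a 0%nat.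
Proof. exact (sum_O (G := C_NormedModule) a). Qed.

Lemma Csum_S (a : nat -> C) (n : nat) : Csum a (S n) = Csum a n + a (S n).
Proof. exact (sum_Sn (G := C_NormedModule) a n). Qed.

Lemma is_Cseries_eps (a : nat -> C) (l : C) :
  is_Cseries a l <->
  (forall eps, 0 < eps -> exists N, forall n, (N <= n)%nat -> Cmod (Csum a n - l) < eps)%R.
Proof.
  split.
  - intros H eps He.
    assert (H' := proj1 (filterlim_locally_ball_norm (K := C_AbsRing) (U := C_NormedModule) _ _) H (mkposreal eps He)).
    exact H'.
  - intros H. apply (filterlim_locally_ball_norm (K := C_AbsRing) (U := C_NormedModule)).
    intros eps. destruct (H eps (cond_pos eps)) as [N HN]. exists N. intros n Hn. exact (HN n Hn).
Qed.

Lemma is_series_R_eps (a : nat -> R) (l : R) :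
  is_series a l <->
  (forall eps, 0 < eps -> exists N, forall n, (N <= n)%nat -> Rabs (sum_n a n - l) < eps)%R.
Proof.
  split.
  - intros H eps He. exact (proj2 (is_lim_seq_spec (sum_n a) l) H (mkposreal eps He)).
  - intros H. apply (is_lim_seq_spec (sum_n a) l). intros eps.
    destruct (H eps (cond_pos eps)) as [N HN]. now exists N.
Qed.

Lemma Re_Csum (a : nat -> C) (n : nat) : Re (Csum a n) = sum_n (fun k => Re (a k)) n.
Proof.
  induction n as [|n IH]. now rewrite Csum_0, sum_O.
  rewrite Csum_S, sum_Sn, <- IH. reflexivity.
Qed.

Lemma Im_Csum (a : nat -> C) (n : nat) : Im (Csum a n) = sum_n (fun k => Im (a k)) n.
Proof.
  induction n as [|n IH]. now rewrite Csum_0, sum_O.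
  rewrite Csum_S, sum_Sn, <- IH. reflexivity.
Qed.

Lemma is_Cseries_components (a : nat -> C) (l : C) :
  is_Cseries a l <->
  is_series (fun n => Re (a n)) (Re l) /\ is_series (fun n => Im (a n)) (Im l).
Proof.
  rewrite is_Cseries_eps, !is_series_R_eps. split.
  - intros H. split; intros eps He; destruct (H eps He) as [N HN]; exists N; intros n Hn;
      specialize (HN n Hn); eapply Rle_lt_trans; try exact HN.
    + rewrite <- Re_Csum. apply (re_le_Cmod (Csum a n - l)).
    + rewrite <- Im_Csum. apply (Im_le_Cmod (Csum a n - l)).
  - intros [H1 H2] eps He.
    destruct (H1 (eps / 2)%R ltac:(lra)) as [N1 HN1].
    destruct (H2 (eps / 2)%R ltac:(lra)) as [N2 HN2].
    exists (max N1 N2). intros n Hn.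
    specialize (HN1 n ltac:(lia)). specialize (HN2 n ltac:(lia)).
    rewrite <- Re_Csum in HN1. rewrite <- Im_Csum in HN2.
    eapply Rle_lt_trans. rewrite (surjective_pairing (Csum a n - l)). apply Cmod_le_abs.
    change (Rabs (Re (Csum a n) - Re l) + Rabs (Im (Csum a n) - Im l) < eps)%R. lra.
Qed.

(** A total sum function, formed on components so that the theory of real [Series] carries over; it
    is meaningful only when both components converge. *)
Definition CSeries (a : nat -> C) : C :=
  (Series (fun n => Re (a n)), Series (fun n => Im (a n))).

Lemma is_Cseries_unique (a : nat -> C) (l : C) : is_Cseries a l -> CSeries a = l.
Proof.
  rewrite is_Cseries_components. intros [H1 H2]. unfold CSeries.
  rewrite (is_series_unique _ _ H1), (is_series_unique _ _ H2).
  symmetry. apply surjective_pairing.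
Qed.

(** Real and imaginary parts are dominated separately, whence the factor 2. *)
Lemma is_Cseries_dominated (a : nat -> C) (b : nat -> R) :
  (forall n, Cmod (a n) <= b n)%R -> ex_series b ->
  is_Cseries a (CSeries a) /\ (Cmod (CSeries a) <= 2 * Series b)%R.
Proof.
  intros H Hb.
  assert (E1 : ex_series (fun n => Rabs (Re (a n)))).
  { apply (ex_series_le (V := R_CompleteNormedModule)) with b; [|assumption].
    intros n. unfold norm; simpl; unfold abs; simpl. rewrite Rabs_Rabsolu.
    eapply Rle_trans; [apply re_le_Cmod|apply H]. }
  assert (E2 : ex_series (fun n => Rabs (Im (a n)))).
  { apply (ex_series_le (V := R_CompleteNormedModule)) with b; [|assumption].
    intros n. unfold norm; simpl; unfold abs; simpl. rewrite Rabs_Rabsolu.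
    eapply Rle_trans; [apply Im_le_Cmod|apply H]. }
  split.
  - apply is_Cseries_components. split; apply Series_correct; now apply ex_series_Rabs.
  - unfold CSeries. eapply Rle_trans. apply Cmod_le_abs.
    assert (Rabs (Series (fun n => Re (a n))) <= Series b)%R.
    { eapply Rle_trans. now apply Series_Rabs. apply Series_le; [|assumption].
      intros n. split. apply Rabs_pos. eapply Rle_trans; [apply re_le_Cmod|apply H]. }
    assert (Rabs (Series (fun n => Im (a n))) <= Series b)%R.
    { eapply Rle_trans. now apply Series_Rabs. apply Series_le; [|assumption].
      intros n. split. apply Rabs_pos. eapply Rle_trans; [apply Im_le_Cmod|apply H]. }
    lra.
Qed.

Lemma is_Cseries_plus (a b : nat -> C) (la lb : C) :
  is_Cseries a la -> is_Cseries b lb -> is_Cseries (fun n => a n + b n) (la + lb).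
Proof. exact (is_series_plus (K := C_AbsRing) (V := C_NormedModule) a b la lb). Qed.

Lemma is_Cseries_scal (c : C) (a : nat -> C) (l : C) :
  is_Cseries a l -> is_Cseries (fun n => c * a n) (c * l).
Proof. exact (is_series_scal (K := C_AbsRing) (V := C_NormedModule) c a l). Qed.

Lemma is_Cseries_ext (a b : nat -> C) (l : C) :
  (forall n, a n = b n) -> is_Cseries a l -> is_Cseries b l.
Proof. exact (is_series_ext (K := C_AbsRing) (V := C_NormedModule) a b l). Qed.

Lemma is_Cseries_cons (a : nat -> C) (l : C) :
  is_Cseries (fun n => a (S n)) l -> is_Cseries a (a 0%nat + l).
Proof.
  intros H. apply (is_series_decr_1 (K := C_AbsRing) (V := C_NormedModule)).
  replace (@plus _ _ _) with l; [exact H|].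
  change (l = a 0%nat + l + - a 0%nat). ring.
Qed.

Definition CPSeries (a : nat -> C) (z : C) : C := CSeries (fun n => a n * z ^ n).

(** A quantitative form of a radius of convergence of at least [/ rho], stable under shifting the
    coefficients. *)
Definition geom_bounded (M rho : R) (a : nat -> C) : Prop :=
  (0 <= M /\ 0 < rho /\ forall n, Cmod (a n) <= M * rho ^ n)%R.

(** This is the second derivative of the geometric series, and differentiation does not change the
    radius of convergence. *)
Lemma ex_series_square_geom (x : R) :
  (0 <= x < 1)%R -> ex_series (fun n => (INR n + 1) * (INR n + 2) * x ^ n)%R.
Proof.
  intros Hx.
  assert (HR : Rbar_lt (Rabs x) (CV_radius (fun _ => 1%R))).
  { apply Rbar_not_le_lt. intros Hle.
    (* The midpoint [(x + 1) / 2] would lie strictly beyond a radius that is at most [x], yet its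
       powers tend to 0. *)
    apply (CV_disk_outside (fun _ => 1%R) ((x + 1) / 2)).
    - eapply Rbar_le_lt_trans. exact Hle. simpl. rewrite !Rabs_pos_eq; lra.
    - apply is_lim_seq_ext with (fun n => ((x + 1) / 2) ^ n)%R. intros; ring.
      apply is_lim_seq_geom. rewrite Rabs_pos_eq; lra. }
  rewrite <- CV_radius_derive, <- CV_radius_derive in HR.
  apply CV_disk_inside in HR.
  refine (ex_series_ext _ _ _ HR). intros n.
  unfold PS_derive. rewrite !S_INR. pose proof (pos_INR n).
  rewrite Rabs_pos_eq. match goal with |- ?u = ?v => change (@eq R u v) end. ring.
  apply Rmult_le_pos; [nra|]. apply pow_le; lra.
Qed.

Lemma is_Cseries_CPSeries (M rho : R) (a : nat -> C) (z : C) :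
  geom_bounded M rho a -> (rho * Cmod z < 1)%R ->
  is_Cseries (fun n => a n * z ^ n) (CPSeries a z) /\
  (Cmod (CPSeries a z) <= 2 * M / (1 - rho * Cmod z))%R.
Proof.
  intros (HM & Hr & H) Hz.
  assert (Hz0 : (0 <= rho * Cmod z)%R) by (apply Rmult_le_pos; [lra|apply Cmod_ge_0]).
  assert (G : is_series (fun n => M * (rho * Cmod z) ^ n)%R (M * / (1 - rho * Cmod z))%R).
  { apply (is_series_scal (K := R_AbsRing) (V := R_NormedModule)). apply is_series_geom.
    now rewrite Rabs_pos_eq. }
  destruct (is_Cseries_dominated (fun n => a n * z ^ n) (fun n => M * (rho * Cmod z) ^ n)%R) as [S1 S2].
  - intros n. rewrite Cmod_mult, Cmod_pow, Rpow_mult_distr, <- Rmult_assoc.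
    apply Rmult_le_compat_r; [|apply H]. apply pow_le, Cmod_ge_0.
  - eexists; exact G.
  - split. exact S1. rewrite (is_series_unique _ _ G) in S2. unfold CPSeries.
    unfold Rdiv. rewrite Rmult_assoc. exact S2.
Qed.

Lemma geom_bounded_shift (M rho : R) (a : nat -> C) :
  geom_bounded M rho a -> geom_bounded (M * rho) rho (fun n => a (S n)).
Proof.
  intros (HM & Hr & H). split; [apply Rmult_le_pos; lra|]. split. assumption.
  intros n. specialize (H (S n)). simpl in H. lra.
Qed.

Lemma CPSeries_cons (M rho : R) (a : nat -> C) (z : C) :
  geom_bounded M rho a -> (rho * Cmod z < 1)%R ->
  CPSeries a z = a 0%nat + z * CPSeries (fun n => a (S n)) z.
Proof.
  intros H Hz.
  destruct (is_Cseries_CPSeries _ _ _ z (geom_bounded_shift _ _ _ H) Hz) as [S1 _].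
  apply is_Cseries_unique.
  replace (a 0%nat) with (a 0%nat * z ^ 0) at 1 by (simpl; ring).
  apply (is_Cseries_cons (fun n => a n * z ^ n)).
  apply (is_Cseries_ext (fun n => z * (a (S n) * z ^ n))).
  intros n. simpl. ring. now apply is_Cseries_scal.
Qed.

Lemma bigO_CPSeries (M rho : R) (a : nat -> C) : geom_bounded M rho a -> bigO 0 (CPSeries a).
Proof.
  intros H. pose proof H as (HM & Hr & _). exists (4 * M)%R, (/ (2 * rho))%R.
  split. lra. split. apply Rinv_0_lt_compat; lra.
  intros z _ Hz.
  assert (Hz' : (rho * Cmod z < 1 / 2)%R).
  { apply Rlt_le_trans with (rho * / (2 * rho))%R. apply Rmult_lt_compat_l; lra.
    right. field. lra. }
  eapply Rle_trans. apply (is_Cseries_CPSeries M rho a z H ltac:(lra)).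
  simpl. apply Rmult_le_reg_r with (1 - rho * Cmod z)%R. lra.
  unfold Rdiv. rewrite Rmult_assoc, Rinv_l by lra. nra.
Qed.

(** Induction on [n]: the remainder for [n + 1] is [y] times the remainder for [n], plus
    [n z^(n-1) (y - z)^2]. The factor [r ^ 2] on the left keeps the exponent of [r] at [n] rather
    than [n - 2]. *)
Lemma Cpow_taylor2 (y z : C) (r : R) (n : nat) :
  (0 < r)%R -> (Cmod y <= r)%R -> (Cmod z <= r)%R ->
  (Cmod (y ^ n - z ^ n - INR n * z ^ pred n * (y - z)) * r ^ 2
   <= INR n ^ 2 * r ^ n * Cmod (y - z) ^ 2)%R.
Proof.
  intros Hr Hy Hz. induction n as [|n IH].
  - simpl. replace (1 - 1 - 0 * 1 * (y - z)) with (RtoC 0) by ring. rewrite Cmod_0. lra.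
  - replace (y ^ S n - z ^ S n - INR (S n) * z ^ pred (S n) * (y - z))
      with (y * (y ^ n - z ^ n - INR n * z ^ pred n * (y - z)) + INR n * z ^ pred n * (y - z) ^ 2).
    2: { destruct n as [|n]. simpl. ring.
         rewrite (S_INR (S n)), RtoC_plus. simpl pred. simpl Cpow. ring. }
    set (T := y ^ n - z ^ n - INR n * z ^ pred n * (y - z)) in *.
    set (h := Cmod (y - z)) in *.
    assert (Hh : (0 <= h)%R) by apply Cmod_ge_0.
    apply Rle_trans with ((r * Cmod T + INR n * Cmod z ^ pred n * h ^ 2) * r ^ 2)%R.
    + apply Rmult_le_compat_r. apply pow2_ge_0.
      eapply Rle_trans. apply Cmod_triangle. rewrite !Cmod_mult, !Cmod_pow, Cmod_R.
      rewrite (Rabs_pos_eq (INR n)) by apply pos_INR. fold h.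
      apply Rplus_le_compat_r. apply Rmult_le_compat_r. apply Cmod_ge_0. assumption.
    + assert (B : (INR n * Cmod z ^ pred n * r ^ 2 <= INR n * r ^ S n)%R).
      { destruct n as [|n]. simpl. lra. simpl pred.
        replace (r ^ S (S n))%R with (r ^ n * r ^ 2)%R by (simpl; ring).
        rewrite Rmult_assoc. apply Rmult_le_compat_l. apply pos_INR.
        apply Rmult_le_compat_r. apply pow2_ge_0. apply pow_incr. split. apply Cmod_ge_0. assumption. }
      pose proof (pow2_ge_0 h). pose proof (pos_INR n). pose proof (pow_lt r n Hr).
      rewrite S_INR.
      apply Rle_trans with (r * (INR n ^ 2 * r ^ n * h ^ 2) + INR n * r ^ S n * h ^ 2)%R.
      * rewrite Rmult_plus_distr_r. apply Rplus_le_compat.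
        rewrite Rmult_assoc. apply Rmult_le_compat_l; lra.
        replace (INR n * Cmod z ^ pred n * h ^ 2 * r ^ 2)%R with (INR n * Cmod z ^ pred n * r ^ 2 * h ^ 2)%R by ring.
        apply Rmult_le_compat_r; lra.
      * simpl (r ^ S n)%R.
        replace (r * (INR n ^ 2 * r ^ n * h ^ 2) + INR n * (r * r ^ n) * h ^ 2)%R
          with ((INR n ^ 2 + INR n) * (r * r ^ n * h ^ 2))%R by ring.
        replace ((INR n + 1) ^ 2 * (r * r ^ n) * h ^ 2)%R
          with ((INR n + 1) ^ 2 * (r * r ^ n * h ^ 2))%R by ring.
        apply Rmult_le_compat_r. repeat apply Rmult_le_pos; lra. nra.
Qed.

Definition Cderive_coeff (a : nat -> C) (n : nat) : C := INR (S n) * a (S n).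

(** The quadratic remainders of the powers are summed against the coefficients, which bounds the
    error by a constant times [|y - z|^2]. *)
Lemma is_Cderive_CPSeries (M rho : R) (a : nat -> C) (z : C) :
  geom_bounded M rho a -> (rho * Cmod z < 1)%R ->
  is_Cderive (CPSeries a) z (CPSeries (Cderive_coeff a) z).
Proof.
  intros H Hz. pose proof H as (HM & Hr & Ha).
  (* Halfway between [|z|] and [/ rho]: points near [z] stay within [r], while [rho * r < 1] keeps
     the majorant convergent. *)
  set (r := ((Cmod z + / rho) / 2)%R).
  assert (Hzr : (Cmod z < / rho)%R).
  { apply Rmult_lt_reg_l with rho. lra. rewrite Rinv_r; lra. }
  assert (Hr1 : (Cmod z < r)%R) by (unfold r; lra).
  assert (Hr0 : (0 < r)%R) by (pose proof (Cmod_ge_0 z); lra).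
  assert (Hr2 : (rho * r < 1)%R).
  { replace 1%R with (rho * / rho)%R by (field; lra). apply Rmult_lt_compat_l. lra. unfold r; lra. }
  set (x := (rho * r)%R) in *.
  assert (Hx : (0 < x)%R) by (now apply Rmult_lt_0_compat).
  assert (EX : ex_series (fun n => M * ((INR n + 1) * (INR n + 2) * x ^ n))%R).
  { apply (ex_series_scal (K := R_AbsRing) (V := R_NormedModule)). apply ex_series_square_geom; lra. }
  set (S0 := Series (fun n => M * ((INR n + 1) * (INR n + 2) * x ^ n))%R) in *.
  assert (HS0 : (0 <= S0)%R).
  { replace 0%R with (Series (fun _ => 0 * 0))%R.
    - apply Series_le; [|assumption]. intros n. pose proof (pos_INR n).
      rewrite Rmult_0_l. split. lra. repeat apply Rmult_le_pos; try lra. apply pow_le; lra.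
    - rewrite Series_scal_l. ring. }
  assert (SD : is_Cseries (fun n => a n * (INR n * z ^ pred n)) (CPSeries (Cderive_coeff a) z)).
  { replace (CPSeries (Cderive_coeff a) z) with (a 0%nat * (INR 0 * z ^ pred 0) + CPSeries (Cderive_coeff a) z)
      by (simpl; ring).
    apply (is_Cseries_cons (fun n => a n * (INR n * z ^ pred n))).
    apply (is_Cseries_ext (fun n => Cderive_coeff a n * z ^ n)).
    { intros n. unfold Cderive_coeff. simpl pred. ring. }
    apply (is_Cseries_dominated _ (fun n => (rho * (M * ((INR n + 1) * (INR n + 2) * x ^ n)))%R)).
    - intros n. unfold Cderive_coeff. rewrite !Cmod_mult, Cmod_R, Cmod_pow, Rabs_pos_eq by apply pos_INR.
      specialize (Ha (S n)). rewrite S_INR. pose proof (pos_INR n).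
      assert (Cmod z ^ n <= r ^ n)%R by (apply pow_incr; split; [apply Cmod_ge_0|lra]).
      pose proof (pow_lt rho n Hr). pose proof (pow_lt r n Hr0).
      apply Rle_trans with ((INR n + 1) * (M * rho ^ S n) * r ^ n)%R.
      { apply Rmult_le_compat; [apply Rmult_le_pos; [lra|apply Cmod_ge_0]|apply pow_le, Cmod_ge_0| |assumption].
        apply Rmult_le_compat_l; lra. }
      unfold x. rewrite Rpow_mult_distr. simpl.
      replace ((INR n + 1) * (M * (rho * rho ^ n)) * r ^ n)%R
        with ((INR n + 1) * 1 * (M * rho * (rho ^ n * r ^ n)))%R by ring.
      replace (rho * (M * ((INR n + 1) * (INR n + 2) * (rho ^ n * r ^ n))))%R
        with ((INR n + 1) * (INR n + 2) * (M * rho * (rho ^ n * r ^ n)))%R by ring.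
      apply Rmult_le_compat_r. repeat apply Rmult_le_pos; lra.
      apply Rmult_le_compat_l; lra.
    - apply (ex_series_scal (K := R_AbsRing) (V := R_NormedModule)). exact EX. }
  apply is_Cderive_eps. intros eps He.
  (* The summed error is at most [2 * S0 * h^2 / r^2]; the added 1 keeps the denominator positive
     when [S0 = 0]. *)
  exists (Rmin (r - Cmod z) (eps * r ^ 2 / (2 * S0 + 1))).
  assert (Hr20 : (0 < r ^ 2)%R) by nra.
  split. { apply Rmin_glb_lt. lra. apply Rdiv_lt_0_compat. nra. lra. }
  intros y Hy.
  assert (Hy1 := Rlt_le_trans _ _ _ Hy (Rmin_l _ _)).
  assert (Hy2 := Rlt_le_trans _ _ _ Hy (Rmin_r _ _)).
  assert (Hyr : (Cmod y <= r)%R).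
  { pose proof (Cmod_triangle (y - z) z) as T. replace (y - z + z) with y in T by ring. lra. }
  assert (SY : is_Cseries (fun n => a n * y ^ n) (CPSeries a y)).
  { apply (is_Cseries_CPSeries M rho a y H).
    apply Rle_lt_trans with x; [|assumption]. apply Rmult_le_compat_l; lra. }
  assert (SZ : is_Cseries (fun n => a n * z ^ n) (CPSeries a z)) by now apply (is_Cseries_CPSeries M rho a z H).
  assert (SS : is_Cseries (fun n => a n * (y ^ n - z ^ n - INR n * z ^ pred n * (y - z)))
     (CPSeries a y - CPSeries a z - CPSeries (Cderive_coeff a) z * (y - z))).
  { replace (CPSeries a y - CPSeries a z - CPSeries (Cderive_coeff a) z * (y - z))
      with (CPSeries a y + (- RtoC 1 * CPSeries a z + - (y - z) * CPSeries (Cderive_coeff a) z)) by ring.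
    eapply is_Cseries_ext; [|apply is_Cseries_plus; [exact SY|apply is_Cseries_plus;
       [apply (is_Cseries_scal (- RtoC 1)); exact SZ|apply (is_Cseries_scal (- (y - z))); exact SD]]].
    intros n. cbv beta. ring. }
  set (h := Cmod (y - z)) in *.
  assert (Hh : (0 <= h)%R) by apply Cmod_ge_0.
  destruct (is_Cseries_dominated (fun n => a n * (y ^ n - z ^ n - INR n * z ^ pred n * (y - z)))
    (fun n => h ^ 2 / r ^ 2 * (M * ((INR n + 1) * (INR n + 2) * x ^ n)))%R) as [_ B].
  { intros n. rewrite Cmod_mult.
    assert (T := Cpow_taylor2 y z r n Hr0 Hyr ltac:(lra)). fold h in T.
    set (X := Cmod (y ^ n - z ^ n - INR n * z ^ pred n * (y - z))) in *.
    assert (HX : (0 <= X)%R) by apply Cmod_ge_0.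
    apply Rmult_le_reg_r with (r ^ 2)%R. assumption.
    replace (h ^ 2 / r ^ 2 * (M * ((INR n + 1) * (INR n + 2) * x ^ n)) * r ^ 2)%R
      with (M * rho ^ n * ((INR n + 1) * (INR n + 2) * r ^ n * h ^ 2))%R
      by (unfold x; rewrite Rpow_mult_distr; field; lra).
    rewrite Rmult_assoc. pose proof (pos_INR n). pose proof (pow_lt r n Hr0).
    apply Rmult_le_compat; [apply Cmod_ge_0|nra|apply Ha|].
    eapply Rle_trans. exact T. apply Rmult_le_compat_r. apply pow2_ge_0.
    apply Rmult_le_compat_r; nra. }
  { apply (ex_series_scal (K := R_AbsRing) (V := R_NormedModule)). exact EX. }
  rewrite Series_scal_l in B. fold S0 in B.
  rewrite (is_Cseries_unique _ _ SS) in B.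
  eapply Rle_trans. exact B.
  assert (h * (2 * S0 + 1) <= eps * r ^ 2)%R.
  { apply Rle_trans with (eps * r ^ 2 / (2 * S0 + 1) * (2 * S0 + 1))%R.
    apply Rmult_le_compat_r; lra. right; field; lra. }
  apply Rmult_le_reg_r with (r ^ 2)%R. assumption.
  replace (2 * (h ^ 2 / r ^ 2 * S0) * r ^ 2)%R with (h * (h * (2 * S0)))%R by (field; lra).
  replace (eps * h * r ^ 2)%R with (h * (eps * r ^ 2))%R by ring.
  apply Rmult_le_compat_l. assumption. nra.
Qed.

(** The chain rule along a radius, split into components so that real mean value arguments apply on
    [[0, 1]]. *)
Lemma is_Cderive_ray (f : C -> C) (z l : C) (t : R) :
  is_Cderive f (t * z) l ->
  is_derive (fun u : R => Re (f (u * z))) t (Re (l * z)) /\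
  is_derive (fun u : R => Im (f (u * z))) t (Im (l * z)).
Proof.
  rewrite is_Cderive_eps. intros H.
  enough (K : forall eps : R, (0 < eps)%R -> exists d : posreal, forall u : R, (Rabs (u - t) < d)%R ->
     (Cmod (f (u * z)%C - f (t * z)%C - (u - t)%R * (l * z)) <= eps * Rabs (u - t))%R).
  { split; (split; [apply is_linear_scal_l|]); intros x Hx eps;
      apply (is_filter_lim_locally_unique (K := R_AbsRing) (V := R_NormedModule)) in Hx; subst x;
      destruct (K eps (cond_pos eps)) as [d Hd]; exists d; intros u Hu; specialize (Hd u Hu);
      (eapply Rle_trans; [|exact Hd]).
    - eapply Rle_trans; [|apply re_le_Cmod]. right. unfold norm, minus, plus, opp, scal; simpl.
      unfold abs, mult; simpl. f_equal. unfold Re, Im; simpl. ring.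
    - eapply Rle_trans; [|apply Im_le_Cmod]. right. unfold norm, minus, plus, opp, scal; simpl.
      unfold abs, mult; simpl. f_equal. unfold Re, Im; simpl. ring. }
  intros eps He.
  assert (Hz := Cmod_ge_0 z).
  destruct (H (eps / (Cmod z + 1))%R ltac:(apply Rdiv_lt_0_compat; lra)) as (d & Hd & Hy).
  assert (Hd' : (0 < d / (Cmod z + 1))%R) by (apply Rdiv_lt_0_compat; lra).
  exists (mkposreal _ Hd'). simpl. intros u Hu. specialize (Hy (u * z)).
  assert (E : u * z - t * z = (u - t)%R * z) by (rewrite RtoC_minus; ring).
  rewrite E, Cmod_mult, Cmod_R in Hy.
  assert (Hq := Rabs_pos (u - t)).
  assert (B1 : (Rabs (u - t) * Cmod z <= Rabs (u - t) * (Cmod z + 1))%R) by (apply Rmult_le_compat_l; lra).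
  assert (B2 : (Rabs (u - t) * (Cmod z + 1) < d)%R).
  { apply Rlt_le_trans with (d / (Cmod z + 1) * (Cmod z + 1))%R.
    apply Rmult_lt_compat_r; lra. right; field; lra. }
  specialize (Hy ltac:(lra)).
  replace ((u - t)%R * (l * z)) with (l * ((u - t)%R * z)) by ring.
  eapply Rle_trans. exact Hy.
  apply Rle_trans with (eps / (Cmod z + 1) * (Rabs (u - t) * (Cmod z + 1)))%R.
  - apply Rmult_le_compat_l; [|assumption]. left. apply Rdiv_lt_0_compat; lra.
  - right. field. lra.
Qed.

Lemma in_disc_ray (z : C) (t : R) : in_disc z -> (0 <= t <= 1)%R -> in_disc (t * z).
Proof.
  unfold in_disc. intros Hz Ht. rewrite Cmod_mult, Cmod_R, Rabs_pos_eq by lra.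
  pose proof (Cmod_ge_0 z). nra.
Qed.

Lemma Cderive_zero_constant (f : C -> C) :
  (forall z, in_disc z -> is_Cderive f z 0) -> forall z, in_disc z -> f z = f 0.
Proof.
  intros H z Hz.
  assert (D : forall t, (0 <= t <= 1)%R ->
    is_derive (fun u : R => Re (f (u * z))) t zero /\ is_derive (fun u : R => Im (f (u * z))) t zero).
  { intros t Ht. destruct (is_Cderive_ray f z 0 t) as [D1 D2].
    apply H. now apply in_disc_ray.
    replace (0 * z) with (RtoC 0) in D1, D2 by ring. now split. }
  assert (E1 := eq_is_derive (V := R_NormedModule) _ 0 1 (fun t Ht => proj1 (D t Ht)) Rlt_0_1).
  assert (E2 := eq_is_derive (V := R_NormedModule) _ 0 1 (fun t Ht => proj2 (D t Ht)) Rlt_0_1).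
  simpl in E1, E2.
  replace (0 * z) with (RtoC 0) in E1, E2 by ring.
  replace (1 * z) with z in E1, E2 by ring.
  rewrite (surjective_pairing (f z)), (surjective_pairing (f 0)).
  unfold Re, Im in E1, E2. now rewrite E1, E2.
Qed.

Definition convolution (a b : nat -> C) (n : nat) : C := Csum (fun k => a k * b (n - k)%nat) n.

Lemma sum_n_Rminus (u v : nat -> R) (n : nat) :
  sum_n (fun k => u k - v k)%R n = (sum_n u n - sum_n v n)%R.
Proof.
  induction n as [|n IH]. now rewrite !sum_O.
  rewrite !sum_Sn, IH. unfold plus; simpl. match goal with |- ?a = ?b => change (@eq R a b) end. ring.
Qed.

(** The Cauchy product, obtained from the four products of real and imaginary parts, each absolutely
    convergent by the geometric majorant. *)
Lemma is_Cseries_convolution (M N rho : R) (a b : nat -> C) (z : C) :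
  geom_bounded M rho a -> geom_bounded N rho b -> (rho * Cmod z < 1)%R ->
  is_Cseries (fun n => convolution a b n * z ^ n) (CPSeries a z * CPSeries b z).
Proof.
  intros Ha Hb Hz.
  assert (Ab : forall (K : R) (c : nat -> C), geom_bounded K rho c ->
    let s := fun n => c n * z ^ n in
    is_series (fun n => Re (s n)) (Re (CPSeries c z)) /\
    is_series (fun n => Im (s n)) (Im (CPSeries c z)) /\
    ex_series (fun n => Rabs (Re (s n))) /\ ex_series (fun n => Rabs (Im (s n)))).
  { intros K c Hc s. destruct (is_Cseries_CPSeries K rho c z Hc Hz) as [S1 _].
    apply is_Cseries_components in S1. destruct S1 as [S1 S2]. split. exact S1. split. exact S2.
    destruct Hc as (HK & Hr & Hc).
    assert (G : ex_series (fun n => K * (rho * Cmod z) ^ n)%R).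
    { apply (ex_series_scal (K := R_AbsRing) (V := R_NormedModule)). apply ex_series_geom.
      rewrite Rabs_pos_eq. assumption. apply Rmult_le_pos. lra. apply Cmod_ge_0. }
    assert (Bn : forall n, (Cmod (s n) <= K * (rho * Cmod z) ^ n)%R).
    { intros n. unfold s. rewrite Cmod_mult, Cmod_pow, Rpow_mult_distr, <- Rmult_assoc.
      apply Rmult_le_compat_r; [|apply Hc]. apply pow_le, Cmod_ge_0. }
    split; apply (ex_series_le (V := R_CompleteNormedModule)) with (fun n => K * (rho * Cmod z) ^ n)%R;
      try assumption; intros n; (eapply Rle_trans; [|apply Bn]).
    - change (Rabs (Rabs (Re (s n))) <= Cmod (s n))%R. rewrite Rabs_Rabsolu. apply re_le_Cmod.
    - change (Rabs (Rabs (Im (s n))) <= Cmod (s n))%R. rewrite Rabs_Rabsolu. apply Im_le_Cmod. }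
  destruct (Ab M a Ha) as (A1 & A2 & A3 & A4). destruct (Ab N b Hb) as (B1 & B2 & B3 & B4).
  assert (RR := is_series_mult _ _ _ _ A1 B1 A3 B3).
  assert (II := is_series_mult _ _ _ _ A2 B2 A4 B4).
  assert (RI := is_series_mult _ _ _ _ A1 B2 A3 B4).
  assert (IR := is_series_mult _ _ _ _ A2 B1 A4 B3).
  apply is_Cseries_components.
  assert (E : forall n, convolution a b n * z ^ n =
    Csum (fun k => (a k * z ^ k) * (b (n - k)%nat * z ^ (n - k))) n).
  { intros n. unfold convolution, Csum. rewrite <- (sum_n_mult_r (K := C_Ring)).
    apply (sum_n_ext_loc (G := C_NormedModule)). intros k Hk.
    change (a k * b (n - k)%nat * z ^ n = a k * z ^ k * (b (n - k)%nat * z ^ (n - k))).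
    replace n with (k + (n - k))%nat at 2 by lia. rewrite Cpow_add_r. ring. }
  split.
  - rewrite Re_Cmult. eapply is_series_ext; [|exact (is_series_minus _ _ _ _ RR II)].
    intros n. rewrite E, Re_Csum, <- !sum_n_Reals.
    exact (eq_sym (sum_n_Rminus _ _ n)).
  - rewrite Im_Cmult. eapply is_series_ext; [|exact (is_series_plus _ _ _ _ RI IR)].
    intros n. rewrite E, Im_Csum, <- !sum_n_Reals, <- sum_n_plus. apply sum_n_ext. intros k.
    reflexivity.
Qed.

Lemma pow_n_Cpow (z : C) (n : nat) : pow_n (K := C_AbsRing) z n = z ^ n.
Proof. induction n as [|n IH]; [reflexivity|]. simpl. rewrite IH. reflexivity. Qed.

Lemma is_pseries_is_Cseries (a : nat -> C) (z l : C) :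
  is_pseries (K := C_AbsRing) (V := C_NormedModule) a z l <->
  is_Cseries (fun n => a n * z ^ n) l.
Proof.
  assert (E : forall n, scal (pow_n (K := C_AbsRing) z n) (a n : C_NormedModule) = a n * z ^ n).
  { intros n. rewrite pow_n_Cpow. apply Cmult_comm. }
  split; apply is_Cseries_ext; intros n; [|symmetry]; apply E.
Qed.

(** Convergence at [z = 1/2] bounds the terms [a n / 2^n], which gives [rho = 2]. The resulting
    small disc is enough for expansions at 0. *)
Lemma taylor_geom_bounded (f : C -> C) (a : nat -> C) :
  taylor_on_disc f a ->
  exists M, geom_bounded M 2 a /\ forall z, (2 * Cmod z < 1)%R -> f z = CPSeries a z.
Proof.
  intros H.
  assert (Hh : in_disc (RtoC (/ 2))).
  { unfold in_disc. rewrite Cmod_R, Rabs_pos_eq; lra. }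
  assert (S1 := proj1 (is_pseries_is_Cseries _ _ _) (H _ Hh)).
  apply is_Cseries_components in S1. destruct S1 as [S1 S2].
  assert (Bd : forall u : nat -> R, ex_series u -> exists K, forall n, (Rabs (u n) <= K)%R).
  { intros u Hu. apply ex_series_lim_0 in Hu.
    destruct (filterlim_bounded (K := R_AbsRing) (V := R_NormedModule) u) as [K HK]; [now exists 0%R|now exists K]. }
  destruct (Bd _ (ex_intro _ _ S1)) as [K1 HK1]. destruct (Bd _ (ex_intro _ _ S2)) as [K2 HK2].
  exists (K1 + K2)%R. split.
  - split. { pose proof (HK1 0%nat). pose proof (HK2 0%nat).
      pose proof (Rabs_pos (Re (a 0%nat * RtoC (/ 2) ^ 0))).
      pose proof (Rabs_pos (Im (a 0%nat * RtoC (/ 2) ^ 0))). lra. }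
    split. lra. intros n. specialize (HK1 n). specialize (HK2 n).
    assert (B : (Cmod (a n * RtoC (/ 2) ^ n) <= K1 + K2)%R).
    { rewrite (surjective_pairing (a n * RtoC (/ 2) ^ n)). eapply Rle_trans. apply Cmod_le_abs.
      unfold Re, Im in *. lra. }
    rewrite Cmod_mult, Cmod_pow, Cmod_R, Rabs_pos_eq in B by lra.
    rewrite pow_inv in B. pose proof (pow_lt 2 n ltac:(lra)) as P.
    apply Rmult_le_reg_r with (/ 2 ^ n)%R. now apply Rinv_0_lt_compat.
    rewrite Rmult_assoc, Rinv_r by lra. lra.
  - intros z Hz. symmetry. apply is_Cseries_unique. apply is_pseries_is_Cseries.
    apply H. unfold in_disc. pose proof (Cmod_ge_0 z). lra.
Qed.

(** * Gregory coefficients *)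

(** The recursion uses all earlier values, so [tab n] carries a whole table that is correct up to
    index [n], and the sequence is its diagonal. *)
Lemma convolution_recurrence (s d : nat -> R) :
  exists a : nat -> R, a 0%nat = 1%R /\
    forall n, (a (S n) = s n * sum_f_R0 (fun k => a k * d (n - k)%nat) n)%R.
Proof.
  pose (tab := fix tab (n : nat) : nat -> R := match n with
    | O => fun _ => 1%R
    | S m => fun k => if (k <=? m)%nat then tab m k
                      else (s m * sum_f_R0 (fun j => tab m j * d (m - j)%nat) m)%R end).
  assert (T : forall m k, tab (S m) k = if (k <=? m)%nat then tab m k
    else (s m * sum_f_R0 (fun j => tab m j * d (m - j)%nat) m)%R) by reflexivity.
  assert (E : forall k j, tab (k + j)%nat k = tab k k).
  { intros k j. induction j as [|j IH]. now rewrite Nat.add_0_r.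
    rewrite Nat.add_succ_r, T, <- IH.
    destruct (Nat.leb_spec k (k + j)); [reflexivity|lia]. }
  exists (fun n => tab n n). split. reflexivity.
  intros n. rewrite T. destruct (Nat.leb_spec (S n) n); [lia|].
  f_equal. apply sum_eq. intros k Hk. f_equal.
  replace n with (k + (n - k))%nat at 1 by lia. apply E.
Qed.

(* Kaluza's argument: the reciprocal of a series with log-convex coefficients has
   nonpositive coefficients after the first, here for [1, 1/2, 1/3, ...]. *)
Lemma kaluza_harmonic (e : nat -> R) :
  e 0%nat = 1%R ->
  (forall n, e (S n) = -1 * sum_f_R0 (fun k => e k * / (INR (n - k) + 2)) n)%R ->
  forall n, (-1 <= e (S n) <= 0)%R.
Proof.
  intros H0 HS.
  (* The recurrence makes this sum, a coefficient of the product of [e] with the series of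
     [1 / (j + 1)], equal to 1 for [n = 0] and to 0 afterwards. *)
  assert (Z : forall n, (0 <= sum_f_R0 (fun k => e k * / (INR (n - k) + 1)) n)%R).
  { intros [|n]. { simpl. rewrite H0. lra. }
    rewrite tech5, Nat.sub_diag, HS. change (INR 0) with 0%R. right.
    replace (sum_f_R0 (fun k => e k * / (INR (S n - k) + 1))%R n)
      with (sum_f_R0 (fun k => e k * / (INR (n - k) + 2))%R n).
    - field.
    - apply sum_eq. intros k Hk. replace (S n - k)%nat with (S (n - k)) by lia.
      rewrite S_INR. f_equal. f_equal. ring. }
  intros n. induction n as [n IH] using (well_founded_induction Wf_nat.lt_wf).
  assert (Neg : forall k, (1 <= k <= n)%nat -> (e k <= 0)%R).
  { intros [|k] Hk; [lia|]. apply (IH k). lia. }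
  rewrite HS. set (sg := sum_f_R0 (fun k => e k * / (INR (n - k) + 2))%R n).
  pose proof (pos_INR n) as Pn.
  assert (L : (sg <= / (INR n + 2))%R).
  { unfold sg. destruct n as [|n]. { simpl. rewrite H0. lra. }
    rewrite (decomp_sum _ (S n)) by lia. simpl pred. rewrite Nat.sub_0_r, H0, Rmult_1_l.
    rewrite <- (Rplus_0_r (/ (INR (S n) + 2))) at 2. apply Rplus_le_compat_l.
    replace 0%R with (sum_f_R0 (fun _ => 0) n)%R by (rewrite sum_cte; ring).
    apply sum_Rle. intros k Hk. pose proof (pos_INR (S n - S k)).
    assert (0 < / (INR (S n - S k) + 2))%R by (apply Rinv_0_lt_compat; lra).
    specialize (Neg (S k) ltac:(lia)). nra. }
  assert (G : (0 <= sg)%R).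
  { specialize (Z n).
    (* Log-convexity enters here: [(m + 1) / (m + 2)] increases with [m], so scaling by its value at
       [m = n] is exact for [k = 0] and, the other [e k] being nonpositive, underestimates every
       other term. *)
    apply Rle_trans with ((INR n + 1) / (INR n + 2) * sum_f_R0 (fun k => e k * / (INR (n - k) + 1)) n)%R.
    - apply Rmult_le_pos; [|assumption]. left. apply Rdiv_lt_0_compat; lra.
    - unfold sg. rewrite scal_sum. apply sum_Rle. intros k Hk.
      destruct k as [|k].
      + rewrite Nat.sub_0_r. right. field. lra.
      + specialize (Neg (S k) ltac:(lia)).
        rewrite minus_INR by lia. set (m := (INR n - INR (S k))%R).
        assert (Hm : (0 <= m <= INR n)%R).
        { unfold m. apply le_INR in Hk. pose proof (pos_INR (S k)). lra. }
        assert (B : (/ (m + 2) <= / (m + 1) * ((INR n + 1) / (INR n + 2)))%R).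
        { apply Rmult_le_reg_r with ((m + 1) * (m + 2) * (INR n + 2))%R. nra.
          replace (/ (m + 2) * ((m + 1) * (m + 2) * (INR n + 2)))%R with ((m + 1) * (INR n + 2))%R by (field; lra).
          replace (/ (m + 1) * ((INR n + 1) / (INR n + 2)) * ((m + 1) * (m + 2) * (INR n + 2)))%R
            with ((m + 2) * (INR n + 1))%R by (field; lra). nra. }
        nra. }
  assert (/ (INR n + 2) <= 1)%R.
  { rewrite <- Rinv_1. apply Rinv_le_contravar; lra. }
  lra.
Qed.

Lemma Csum_RtoC (u : nat -> R) (n : nat) :
  Csum (fun k => RtoC (u k)) n = RtoC (sum_f_R0 u n).
Proof.
  induction n as [|n IH]. apply Csum_0.
  rewrite Csum_S, IH. simpl. now rewrite RtoC_plus.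
Qed.

Lemma geom_bounded_RtoC (u : nat -> R) :
  (forall n, Rabs (u n) <= 1)%R -> geom_bounded 1 1 (fun n => RtoC (u n)).
Proof.
  intros H. split. lra. split. lra. intros n. rewrite Cmod_R, pow1, Rmult_1_r. apply H.
Qed.

Lemma CPSeries_ext (a b : nat -> C) (z : C) :
  (forall n, a n = b n) -> CPSeries a z = CPSeries b z.
Proof.
  intros H. unfold CPSeries, CSeries. f_equal; apply Series_ext; intros n; now rewrite H.
Qed.

Lemma CPSeries_at_0 (M rho : R) (a : nat -> C) : geom_bounded M rho a -> CPSeries a 0 = a 0%nat.
Proof.
  intros H. rewrite (CPSeries_cons M rho a 0 H). ring. rewrite Cmod_0. lra.
Qed.

Lemma CPSeries_const (c z : C) : CPSeries (fun n => match n with O => c | S _ => 0 end) z = c.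
Proof.
  apply is_Cseries_unique. apply is_Cseries_eps. intros eps He. exists 0%nat. intros n _.
  replace (Csum _ n) with c. { replace (c - c) with (RtoC 0) by ring. now rewrite Cmod_0. }
  induction n as [|n IH]. rewrite Csum_0. simpl. ring.
  rewrite Csum_S, <- IH. ring.
Qed.

(** Coefficients of [Clog (1 + z) / z], the series whose reciprocal is [Psi]. *)
Definition log_coeff (n : nat) : R := ((-1) ^ n / (INR n + 1))%R.

Lemma Rabs_pow_m1 (n : nat) : Rabs ((-1) ^ n) = 1%R.
Proof.
  rewrite <- RPow_abs, (Rabs_left (-1)) by lra.
  replace (- (-1))%R with 1%R by ring. apply pow1.
Qed.

Lemma log_coeff_bound (n : nat) : (Rabs (log_coeff n) <= 1)%R.
Proof.
  unfold log_coeff. pose proof (pos_INR n). unfold Rdiv.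
  rewrite Rabs_mult, Rabs_pow_m1, Rmult_1_l, Rabs_pos_eq.
  - assert (I := Rinv_le_contravar 1 (INR n + 1) Rlt_0_1 ltac:(lra)). now rewrite Rinv_1 in I.
  - left. apply Rinv_0_lt_compat. lra.
Qed.

(** Peeling off the first term gives [S0 = 1 - z * S0]. *)
Lemma CPSeries_geom (z : C) :
  in_disc z -> CPSeries (fun n => RtoC ((-1) ^ n)) z = / (1 + z).
Proof.
  intros Hz. unfold in_disc in Hz.
  assert (G : geom_bounded 1 1 (fun n => RtoC ((-1) ^ n))).
  { apply geom_bounded_RtoC. intros n. rewrite Rabs_pow_m1. lra. }
  assert (E := CPSeries_cons 1 1 _ z G ltac:(lra)). cbv beta in E.
  set (S0 := CPSeries (fun n => RtoC ((-1) ^ n)) z) in *.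
  assert (E' : CPSeries (fun n => RtoC ((-1) ^ S n)) z = - RtoC 1 * S0).
  { apply is_Cseries_unique.
    apply (is_Cseries_ext (fun n => - RtoC 1 * (RtoC ((-1) ^ n) * z ^ n))).
    - intros n. simpl. rewrite RtoC_mult. ring.
    - apply is_Cseries_scal. apply (is_Cseries_CPSeries 1 1 _ z G). lra. }
  rewrite E' in E. simpl in E.
  assert (N : 1 + z <> 0).
  { intros N. assert (z = - RtoC 1) by (replace z with (1 + z - 1) by ring; rewrite N; ring).
    subst z. rewrite Cmod_opp, Cmod_1 in Hz. lra. }
  apply (f_equal (fun u => (u + z * S0) / (1 + z))) in E.
  replace ((S0 + z * S0) / (1 + z)) with S0 in E by (field; assumption).
  rewrite E. field. assumption.
Qed.

(** Both sides vanish at 0 and have the same derivative along the segment from 0 to [z]. Since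
    [1 + t z] has positive real part there, [Clog] consists of [ln] of the modulus and [atan] of the
    slope, and the two components are differentiated as real functions. *)
Lemma CPSeries_log (z : C) :
  in_disc z -> z * CPSeries (fun n => RtoC (log_coeff n)) z = Clog (1 + z).
Proof.
  intros Hz.
  pose (l := fun n => match n with O => RtoC 0 | S m => RtoC (log_coeff m) end).
  assert (Gl : geom_bounded 1 1 l).
  { split. lra. split. lra. intros n. rewrite pow1. destruct n as [|n]; simpl.
    rewrite Cmod_0. lra. rewrite Cmod_R. pose proof (log_coeff_bound n). lra. }
  assert (E : forall y, in_disc y -> CPSeries l y = y * CPSeries (fun n => RtoC (log_coeff n)) y).
  { intros y Hy. unfold in_disc in Hy. rewrite (CPSeries_cons 1 1 l y Gl) by lra. simpl. ring. }
  rewrite <- E by assumption.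
  assert (D : forall y, in_disc y -> is_Cderive (CPSeries l) y (/ (1 + y))).
  { intros y Hy. rewrite <- CPSeries_geom by assumption.
    rewrite <- (CPSeries_ext (Cderive_coeff l)).
    - apply (is_Cderive_CPSeries 1 1). assumption. unfold in_disc in Hy. lra.
    - intros n. unfold Cderive_coeff, l, log_coeff. rewrite <- RtoC_mult. f_equal.
      rewrite S_INR. pose proof (pos_INR n). field. lra. }
  destruct z as [x y].
  assert (Hx : (-1 < x)%R).
  { unfold in_disc in Hz. pose proof (re_le_Cmod (x, y)) as B. simpl in B.
    apply Rabs_le_between in B. lra. }
  assert (Pos : forall t, (0 <= t <= 1)%R -> (0 < 1 + t * x)%R).
  { intros t Ht. destruct (Rle_dec 0 x); nra. }
  assert (Q : forall t, (0 <= t <= 1)%R -> (0 < (1 + t * x) ^ 2 + (t * y) ^ 2)%R).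
  { intros t Ht. specialize (Pos t Ht). pose proof (pow2_ge_0 (t * y)). nra. }
  assert (F : forall t, (0 <= t <= 1)%R ->
     is_derive (fun u : R => Re (CPSeries l (u * (x, y)))) t
       ((x * (1 + t * x) + t * y * y) / ((1 + t * x) ^ 2 + (t * y) ^ 2))%R /\
     is_derive (fun u : R => Im (CPSeries l (u * (x, y)))) t
       (y / ((1 + t * x) ^ 2 + (t * y) ^ 2))%R).
  { intros t Ht. destruct (is_Cderive_ray _ _ _ _ (D _ (in_disc_ray _ t Hz Ht))) as [D1 D2].
    specialize (Q t Ht).
    assert (Ew : / (1 + t * (x, y)) * (x, y) =
      (((x * (1 + t * x) + t * y * y) / ((1 + t * x) ^ 2 + (t * y) ^ 2))%R,
       (y / ((1 + t * x) ^ 2 + (t * y) ^ 2))%R)).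
    { unfold Cinv, Cmult, Cplus, RtoC; simpl. 
      f_equal; field; simpl in Q; nra. }
    rewrite Ew in D1, D2. now split. }
  set (g1 := fun t : R => (Re (CPSeries l (t * (x, y))) - ln (sqrt ((1 + t * x) ^ 2 + (t * y) ^ 2)))%R).
  set (g2 := fun t : R => (Im (CPSeries l (t * (x, y))) - atan (t * y / (1 + t * x)))%R).
  assert (G1 : g1 0%R = g1 1%R).
  { apply (eq_is_derive (V := R_NormedModule)); [|lra]. intros t Ht.
    destruct (F t Ht) as [D1 _]. specialize (Q t Ht).
    replace (@zero R_NormedModule) with (minus ((x * (1 + t * x) + t * y * y) / ((1 + t * x) ^ 2 + (t * y) ^ 2))%R
       ((x * (1 + t * x) + t * y * y) / ((1 + t * x) ^ 2 + (t * y) ^ 2))%R) by apply (minus_eq_zero (G := R_AbelianGroup)).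
    apply (is_derive_minus (K := R_AbsRing) (V := R_NormedModule)). exact D1.
    assert (Sq : (0 < sqrt ((1 + t * x) ^ 2 + (t * y) ^ 2))%R) by now apply sqrt_lt_R0.
    auto_derive. simpl in Q, Sq |- *. split; [lra|]. split; [|trivial]. exact Sq.
    pose proof (sqrt_sqrt _ (Rlt_le _ _ Q)) as SS.
    set (w := sqrt ((1 + t * x) ^ 2 + (t * y) ^ 2)) in *.
    change ((1 + t * x) * ((1 + t * x) * 1) + t * y * (t * y * 1))%R with ((1 + t * x) ^ 2 + (t * y) ^ 2)%R.
    fold w. rewrite <- SS. field. lra. }
  assert (G2 : g2 0%R = g2 1%R).
  { apply (eq_is_derive (V := R_NormedModule)); [|lra]. intros t Ht.
    destruct (F t Ht) as [_ D2]. specialize (Q t Ht). specialize (Pos t Ht).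
    replace (@zero R_NormedModule) with (minus (y / ((1 + t * x) ^ 2 + (t * y) ^ 2))%R
       (y / ((1 + t * x) ^ 2 + (t * y) ^ 2))%R) by apply (minus_eq_zero (G := R_AbelianGroup)).
    apply (is_derive_minus (K := R_AbsRing) (V := R_NormedModule)). exact D2.
    auto_derive. lra. unfold Rsqr. field. repeat split; nra. }
  unfold g1, g2 in G1, G2.
  rewrite (Cmult_0_l (x, y)) in G1, G2.
  replace (1%R * (x, y)) with ((x, y) : C) in G1, G2 by (symmetry; apply Cmult_1_l).
  rewrite (CPSeries_at_0 1 1 l Gl) in G1, G2. simpl (l 0%nat) in G1, G2.
  rewrite re_RtoC in G1. rewrite im_RtoC in G2.
  replace ((1 + 0 * x) ^ 2 + (0 * y) ^ 2)%R with 1%R in G1 by ring.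
  rewrite sqrt_1, ln_1 in G1.
  replace (0 * y / (1 + 0 * x))%R with 0%R in G2 by (field; lra). rewrite atan_0 in G2.
  rewrite !Rmult_1_l in G1, G2.
  rewrite (surjective_pairing (CPSeries l (x, y))).
  change (fst (CPSeries l (x, y))) with (Re (CPSeries l (x, y))).
  change (snd (CPSeries l (x, y))) with (Im (CPSeries l (x, y))).
  unfold Clog. f_equal.
  - replace (Cmod (1 + (x, y))) with (sqrt ((1 + x) ^ 2 + y ^ 2)). lra.
    unfold Cmod. simpl. now rewrite Rplus_0_l.
  - unfold Arg. change (Re (1 + (x, y))) with (1 + x)%R. change (Im (1 + (x, y))) with (0 + y)%R.
    rewrite Rplus_0_l.
    destruct (Rlt_dec 0 (1 + x)); lra.
Qed.

(** Replacing [z] by [-z] turns the coefficients of [Clog (1 + z) / z] into [1 / (n + 1)], whose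
    reciprocal has coefficients [e n] between -1 and 0 after the first. Undoing the sign gives
    [(-1)^n e n], bounded by 1, hence a series that converges on the whole disc. *)
Lemma gregory_series : exists P : nat -> R,
  (P 0%nat = 1 /\ P 1%nat = 1 / 2 /\ P 2%nat = - (1 / 12) /\ P 3%nat = 1 / 24 /\
   P 4%nat = - (19 / 720) /\ (forall n, Rabs (P n) <= 1))%R /\
  forall z, in_disc z -> Psi z = CPSeries (fun n => RtoC (P n)) z.
Proof.
  destruct (convolution_recurrence (fun _ => -1)%R (fun j => / (INR j + 2))%R) as (e & e0 & eS).
  assert (Ke := kaluza_harmonic e e0 eS).
  assert (e1 : e 1%nat = (- (1 / 2))%R) by (rewrite eS; simpl; rewrite e0; field).
  assert (e2 : e 2%nat = (- (1 / 12))%R) by (rewrite eS; simpl; rewrite e0, e1; field).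
  assert (e3 : e 3%nat = (- (1 / 24))%R) by (rewrite eS; simpl; rewrite e0, e1, e2; field).
  assert (e4 : e 4%nat = (- (19 / 720))%R) by (rewrite eS; simpl; rewrite e0, e1, e2, e3; field).
  exists (fun n => ((-1) ^ n * e n)%R).
  assert (Bd : forall n, (Rabs ((-1) ^ n * e n) <= 1)%R).
  { intros n. rewrite Rabs_mult, Rabs_pow_m1, Rmult_1_l. apply Rabs_le_between.
    destruct n as [|n]. rewrite e0; lra. specialize (Ke n). lra. }
  split.
  { rewrite e0, e1, e2, e3, e4. simpl. repeat split; try lra. exact Bd. }
  intros z Hz.
  assert (GP := geom_bounded_RtoC _ Bd). assert (GL := geom_bounded_RtoC _ log_coeff_bound).
  unfold Psi. destruct (Ceq_dec z 0) as [->|Nz].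
  { rewrite (CPSeries_at_0 1 1 _ GP). rewrite e0. simpl. f_equal. ring. }
  rewrite <- CPSeries_log by assumption.
  assert (E := is_Cseries_convolution 1 1 1 _ _ z GP GL). unfold in_disc in Hz.
  specialize (E ltac:(lra)). apply is_Cseries_unique in E.
  change (CPSeries (convolution (fun n => RtoC ((-1) ^ n * e n)) (fun n => RtoC (log_coeff n))) z
    = CPSeries (fun n => RtoC ((-1) ^ n * e n)) z * CPSeries (fun n => RtoC (log_coeff n)) z) in E.
  (* The Cauchy product of the two series is the constant 1; this also shows that the logarithm
     factor does not vanish. *)
  rewrite (CPSeries_ext _ (fun n => match n with O => 1 | S _ => 0 end)) in E.
  - rewrite CPSeries_const in E.
    set (Lz := CPSeries (fun n => RtoC (log_coeff n)) z) in *.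
    set (Pz := CPSeries (fun n => RtoC ((-1) ^ n * e n)) z) in *.
    assert (NL : Lz <> 0).
    { intros N. rewrite N in E. apply C1_nz. rewrite E. ring. }
    transitivity ((Pz * Lz) * z / (z * Lz)); [rewrite <- E|]; field; now split.
  - intros n. unfold convolution.
    transitivity (Csum (fun k => RtoC ((-1) ^ n * (e k * / (INR (n - k) + 1)))) n).
    { unfold Csum. apply (sum_n_ext_loc (G := C_NormedModule)). intros k Hk.
      rewrite <- RtoC_mult. apply (f_equal RtoC). unfold log_coeff.
      replace n with (k + (n - k))%nat at 3 by lia. rewrite pow_add. unfold Rdiv. ring. }
    rewrite Csum_RtoC.
    destruct n as [|n].
    { simpl. rewrite e0. apply (f_equal RtoC). field. }
    apply (f_equal RtoC).
    rewrite (sum_eq _ (fun k => e k * / (INR (S n - k) + 1) * (-1) ^ S n)%R) by (intros; ring).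
    rewrite <- scal_sum. rewrite tech5, Nat.sub_diag, eS. change (INR 0) with 0%R.
    replace (sum_f_R0 (fun k => e k * / (INR (S n - k) + 1))%R n)
      with (sum_f_R0 (fun k => e k * / (INR (n - k) + 2))%R n).
    + field.
    + apply sum_eq. intros k Hk. replace (S n - k)%nat with (S (n - k)) by lia.
      rewrite S_INR. f_equal. f_equal. ring.
Qed.

(** * The extremal function *)

(** Comparing coefficients in [dB/dz = kappa B D] expresses [b (n + 1)] as [kappa / (n + 1)] times a
    sum of [n + 1] products, so the bound 1 propagates by induction. *)
Lemma linear_ode_series (kappa : R) (d : nat -> R) :
  (Rabs kappa <= 1)%R -> (forall n, Rabs (d n) <= 1)%R ->
  exists b : nat -> R, (b 0%nat = 1 /\ b 1%nat = kappa * d 0%nat)%R /\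
    (forall n, Rabs (b n) <= 1)%R /\
    forall z, in_disc z ->
      is_Cderive (CPSeries (fun n => RtoC (b n))) z
        (kappa * (CPSeries (fun n => RtoC (b n)) z * CPSeries (fun n => RtoC (d n)) z)).
Proof.
  intros Hk Hd.
  destruct (convolution_recurrence (fun n => kappa / (INR n + 1))%R d) as (b & b0 & bS).
  assert (Bd : forall n, (Rabs (b n) <= 1)%R).
  { intros n. induction n as [n IH] using (well_founded_induction Wf_nat.lt_wf).
    destruct n as [|n]. rewrite b0, Rabs_R1. lra.
    rewrite bS, Rabs_mult. pose proof (pos_INR n).
    assert (S1 : (Rabs (sum_f_R0 (fun k => b k * d (n - k)%nat) n) <= INR n + 1)%R).
    { eapply Rle_trans. apply Rsum_abs. rewrite <- S_INR, <- (Rmult_1_l (INR (S n))).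
      rewrite <- sum_cte. apply sum_Rle. intros k Hk'. rewrite Rabs_mult.
      specialize (IH k ltac:(lia)). specialize (Hd (n - k)%nat).
      pose proof (Rabs_pos (b k)). pose proof (Rabs_pos (d (n - k)%nat)). nra. }
    assert (S2 : (Rabs (kappa / (INR n + 1)) <= / (INR n + 1))%R).
    { unfold Rdiv. assert (0 < / (INR n + 1))%R by (apply Rinv_0_lt_compat; lra).
      rewrite Rabs_mult, (Rabs_pos_eq (/ (INR n + 1))) by lra. nra. }
    apply Rle_trans with (/ (INR n + 1) * (INR n + 1))%R.
    apply Rmult_le_compat; try apply Rabs_pos; assumption. right. field. lra. }
  exists b. split. { split. exact b0. rewrite bS. simpl. rewrite b0. field. }
  split. exact Bd.
  intros z Hz. unfold in_disc in Hz.
  assert (Gb := geom_bounded_RtoC b Bd). assert (Gd := geom_bounded_RtoC d Hd).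
  assert (Conv := is_Cseries_convolution 1 1 1 _ _ z Gb Gd ltac:(lra)).
  apply (is_Cseries_scal kappa) in Conv.
  rewrite <- (is_Cseries_unique _ _ Conv).
  replace (CSeries _) with (CPSeries (Cderive_coeff (fun n => RtoC (b n))) z).
  { apply (is_Cderive_CPSeries 1 1). exact Gb. lra. }
  rewrite (CPSeries_ext _ (fun n => kappa * convolution (fun n => RtoC (b n)) (fun n => RtoC (d n)) n)).
  - unfold CPSeries. unfold CSeries. f_equal; apply Series_ext; intros n; f_equal; ring.
  - intros n. unfold Cderive_coeff, convolution.
    transitivity (RtoC kappa * Csum (fun k => RtoC (b k * d (n - k)%nat)) n).
    + rewrite Csum_RtoC, <- !RtoC_mult. apply (f_equal RtoC). rewrite bS, S_INR.
      pose proof (pos_INR n). field. lra.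
    + f_equal. apply (sum_n_ext (G := C_NormedModule)). intros k. apply RtoC_mult.
Qed.

(** These are the coefficients of [z B(z^4)]. New terms arise only at the indices [4 m + 1], so the
    partial sums stay constant over the three indices that follow. *)
Lemma Csum_lacunary (b : nat -> C) (z : C) (m j : nat) :
  (j < 4)%nat ->
  Csum (fun n => (if (n mod 4 =? 1)%nat then b (n / 4)%nat else 0) * z ^ n) (4 * m + 1 + j)
  = z * Csum (fun k => b k * (z ^ 4) ^ k) m.
Proof.
  set (t := fun n => (if (n mod 4 =? 1)%nat then b (n / 4)%nat else 0) * z ^ n).
  assert (T1 : forall m, t (4 * m + 1)%nat = z * (b m * (z ^ 4) ^ m)).
  { intros k. unfold t. replace (4 * k + 1)%nat with (1 + k * 4)%nat by lia.
    rewrite Nat.Div0.mod_add, Nat.div_add by lia. simpl (1 mod 4 =? 1)%nat. simpl (1 / 4 + k)%nat. cbv iota.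
    rewrite <- Cpow_mult_r, (Nat.mul_comm 4 k), Cpow_add_r. simpl. ring. }
  assert (T0 : forall m i, (1 <= i < 4)%nat -> t (4 * m + 1 + i)%nat = 0).
  { intros k i Hi. unfold t. replace (4 * k + 1 + i)%nat with ((1 + i) + k * 4)%nat by lia.
    rewrite Nat.Div0.mod_add.
    destruct i as [|[|[|[|i]]]]; try lia; simpl; ring. }
  assert (Step : forall m, Csum t (4 * m + 1) = z * Csum (fun k => b k * (z ^ 4) ^ k) m ->
     forall i, (i < 4)%nat -> Csum t (4 * m + 1 + i) = z * Csum (fun k => b k * (z ^ 4) ^ k) m).
  { intros k H i. induction i as [|i IH]; intros Hi. now rewrite Nat.add_0_r.
    replace (4 * k + 1 + S i)%nat with (S (4 * k + 1 + i)) by lia.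
    rewrite Csum_S, IH by lia. replace (S (4 * k + 1 + i)) with (4 * k + 1 + S i)%nat by lia.
    rewrite T0 by lia. ring. }
  assert (Base : forall m, Csum t (4 * m + 1) = z * Csum (fun k => b k * (z ^ 4) ^ k) m).
  { intros k. induction k as [|k IH].
    - change (4 * 0 + 1)%nat with 1%nat. rewrite Csum_S, !Csum_0.
      change 1%nat with (4 * 0 + 1)%nat at 1. rewrite T1. unfold t. simpl. ring.
    - replace (4 * S k + 1)%nat with (S (4 * k + 1 + 3)) by lia.
      rewrite Csum_S, (Step k IH) by lia.
      replace (S (4 * k + 1 + 3)) with (4 * S k + 1)%nat by lia.
      rewrite T1, Csum_S. ring. }
  intros Hj. now apply Step.
Qed.

Lemma is_Cseries_lacunary (b : nat -> C) (z l : C) :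
  is_Cseries (fun n => b n * (z ^ 4) ^ n) l ->
  is_Cseries (fun n => (if (n mod 4 =? 1)%nat then b (n / 4)%nat else 0) * z ^ n) (z * l).
Proof.
  rewrite !is_Cseries_eps. intros H eps He.
  pose proof (Cmod_ge_0 z) as Hz.
  destruct (H (eps / (Cmod z + 1))%R) as [N HN].
  { apply Rdiv_lt_0_compat; lra. }
  exists (4 * N + 1)%nat. intros n Hn.
  replace n with (4 * ((n - 1) / 4) + 1 + (n - 1) mod 4)%nat.
  2: { pose proof (Nat.div_mod_eq (n - 1) 4). lia. }
  rewrite Csum_lacunary by (apply Nat.mod_upper_bound; lia).
  assert (HN' : (N <= (n - 1) / 4)%nat) by (apply Nat.div_le_lower_bound; lia).
  specialize (HN _ HN').
  replace (z * _ - z * l) with (z * (Csum (fun k => b k * (z ^ 4) ^ k) ((n - 1) / 4) - l)) by ring.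
  rewrite Cmod_mult.
  set (X := Cmod (Csum _ _ - l)) in *.
  assert (0 <= X)%R by apply Cmod_ge_0.
  apply Rle_lt_trans with ((Cmod z + 1) * X)%R. nra.
  replace eps with ((Cmod z + 1) * (eps / (Cmod z + 1)))%R by (field; lra).
  apply Rmult_lt_compat_l; lra.
Qed.

Lemma extremal_function :
  exists (f : C -> C) (a : nat -> C),
    class_SG f /\ taylor_on_disc f a /\ Cmod (a 3%nat ^ 2 - a 5%nat) = (1 / 8)%R.
Proof.
  destruct gregory_series as (P & (P0 & P1 & _ & _ & _ & PB) & HP).
  (* The series of [(Psi - 1) / z]. With [f = z B(z^4)] and [u = z^4], the equation
     [z f' = f Psi(u)] becomes [dB/du = B D / 4], whence [kappa = 1/4]. *)
  set (d := fun n => P (S n)).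
  assert (dB : forall n, (Rabs (d n) <= 1)%R) by (intros; apply PB).
  destruct (linear_ode_series (1 / 4) d) as (b & (b0 & b1) & bB & bD);
    [rewrite Rabs_pos_eq; lra|exact dB|].
  destruct (linear_ode_series (- (1 / 4)) d) as (c & (c0 & _) & cB & cD);
    [rewrite Rabs_Ropp, Rabs_pos_eq; lra|exact dB|].
  assert (GP := geom_bounded_RtoC P PB). assert (Gb := geom_bounded_RtoC b bB).
  assert (Gc := geom_bounded_RtoC c cB).
  set (B := CPSeries (fun n => RtoC (b n))) in *. set (B' := CPSeries (fun n => RtoC (c n))) in *.
  set (D := CPSeries (fun n => RtoC (d n))) in *.
  assert (NB : forall z, in_disc z -> B z <> 0).
  { intros z Hz N.
    assert (E : B z * B' z = B 0 * B' 0).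
    (* Here [B'] is the solution for the opposite sign, not a derivative. The two equations cancel
       in the derivative of the product, whose value at 0 is 1. *)
    { apply (Cderive_zero_constant (fun z => B z * B' z)); [|assumption].
      intros y Hy. eapply is_Cderive_ext; [reflexivity| |exact (is_Cderive_mult _ _ _ _ _ (bD y Hy) (cD y Hy))].
      rewrite RtoC_opp. ring. }
    unfold B at 2, B' at 2 in E.
    rewrite (CPSeries_at_0 1 1 _ Gb), (CPSeries_at_0 1 1 _ Gc), b0, c0, N in E.
    apply C1_nz. transitivity (0 * B' z); [rewrite E|]; ring. }
  assert (D4 : forall z, in_disc z -> in_disc (z ^ 4)).
  { unfold in_disc. intros z Hz. rewrite Cmod_pow. pose proof (Cmod_ge_0 z).
    change (Cmod z * Cmod z ^ 3 < 1)%R.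
    assert (Cmod z ^ 3 <= 1)%R by (rewrite <- (pow1 3); apply pow_incr; lra). nra. }
  set (f := fun z => z * B (z ^ 4)).
  set (f' := fun z => B (z ^ 4) + z ^ 4 * (B (z ^ 4) * D (z ^ 4))).
  assert (Df : forall z, in_disc z -> is_Cderive f z (f' z)).
  { intros z Hz. eapply is_Cderive_ext; [reflexivity| |
      apply is_Cderive_mult; [apply is_Cderive_id|
        apply (is_Cderive_comp B (fun z => z ^ 4)); [apply bD, D4, Hz|apply is_Cderive_pow]]].
    unfold f'. rewrite RtoC_div by lra. simpl INR. 
    replace (RtoC (1 + 1 + 1 + 1)) with (RtoC 4) by (f_equal; ring).
    fold D. fold B. field. }
  assert (Psi4 : forall z, in_disc z -> zf'_over_f f z = Psi (z ^ 4)).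
  { intros z Hz. unfold zf'_over_f. destruct (Ceq_dec z 0) as [->|Nz].
    - replace (0 ^ 4) with (RtoC 0) by ring. unfold Psi. destruct (Ceq_dec 0 0); [reflexivity|congruence].
    - rewrite HP by now apply D4.
      rewrite (CPSeries_cons 1 1 _ _ GP) by (pose proof (D4 z Hz) as Q; unfold in_disc in Q; lra).
      rewrite P0. fold d. change (fun n => RtoC (P (S n))) with (fun n => RtoC (d n)). fold D.
      rewrite (is_C_derive_unique f z (f' z) (Df z Hz)). unfold f', f.
      field. split; [now apply NB, D4|assumption]. }
  assert (DPsi : forall z, in_disc z -> exists l, is_Cderive Psi z l).
  { intros z Hz. unfold in_disc in Hz. eexists.
    apply (is_Cderive_ext_loc (CPSeries (fun n => RtoC (P n))) Psi z _ (1 - Cmod z)). lra.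
    - intros x Hx. symmetry. apply HP. unfold in_disc.
      pose proof (Cmod_triangle (x - z) z) as T. replace (x - z + z) with x in T by ring. lra.
    - apply (is_Cderive_CPSeries 1 1 _ z GP). lra. }
  exists f, (fun n => if (n mod 4 =? 1)%nat then RtoC (b (n / 4)%nat) else 0).
  split; [|split].
  - split; [|split].
    + split; [|split].
      * intros z Hz. exists (f' z). now apply Df.
      * unfold f. ring.
      * rewrite (is_C_derive_unique f 0 (f' 0)).
        -- unfold f'. replace (0 ^ 4) with (RtoC 0) by ring. unfold B.
           rewrite (CPSeries_at_0 1 1 _ Gb), b0. ring.
        -- apply Df. unfold in_disc. rewrite Cmod_0. lra.
    + intros z Hz Nz. unfold f. apply Cmult_neq_0. assumption. now apply NB, D4.
    + split; [|split].
      * intros z Hz. destruct (DPsi _ (D4 z Hz)) as [l Hl]. eexists.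
        apply (is_Cderive_ext_loc (fun z => Psi (z ^ 4)) (zf'_over_f f) z _ (1 - Cmod z)).
        -- unfold in_disc in Hz. lra.
        -- intros x Hx. symmetry. apply Psi4. unfold in_disc.
           pose proof (Cmod_triangle (x - z) z) as T. replace (x - z + z) with x in T by ring. lra.
        -- apply (is_Cderive_comp Psi (fun z => z ^ 4)). exact Hl. apply is_Cderive_pow.
      * intros z Hz. destruct (DPsi z Hz) as [l Hl]. exists l. exact Hl.
      * exists (fun z => z ^ 4). split; [|split; [|split]].
        -- intros z Hz. eexists. exact (is_Cderive_pow 3 z).
        -- ring.
        -- intros z Hz. now apply D4.
        -- exact Psi4.
  - intros z Hz. apply is_pseries_is_Cseries. apply (is_Cseries_lacunary (fun n => RtoC (b n)) z).
    apply (is_Cseries_CPSeries 1 1 _ _ Gb). pose proof (D4 z Hz) as Q. unfold in_disc in Q. lra.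
  (* Index 3 is not 1 modulo 4, so the third coefficient is 0, while the fifth is
     [b 1 = P 1 / 4 = 1/8]. *)
  - change (Cmod (0 ^ 2 - RtoC (b 1%nat)) = (1 / 8)%R). rewrite b1. unfold d. rewrite P1.
    replace (0 ^ 2 - RtoC (1 / 4 * (1 / 2))) with (RtoC (- (1 / 8))).
    + rewrite Cmod_R, Rabs_Ropp, Rabs_pos_eq; lra.
    + rewrite <- RtoC_pow, <- RtoC_minus. apply (f_equal RtoC). field.
Qed.

(** * The upper bound *)

(** Near 0 the factor [K] has modulus at least [|kappa| / 2] and can be divided out. This is how an
    estimate for a difference of values of [Psi] becomes one for the arguments. *)
Lemma bigO_cancel (n : nat) (u K : C -> C) (kappa : C) :
  kappa <> 0 -> bigO 1 (fun z => K z - kappa) -> bigO n (fun z => u z * K z) -> bigO n u.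
Proof.
  intros Hk (M & d & HM & Hd & H) (M' & d' & HM' & Hd' & H').
  assert (Hm : (0 < Cmod kappa)%R) by now apply Cmod_gt_0.
  set (m := Cmod kappa) in *.
  assert (He : (0 < m / (2 * (M + 1)))%R) by (apply Rdiv_lt_0_compat; lra).
  exists (M' * (2 / m))%R, (Rmin (Rmin d d') (m / (2 * (M + 1)))).
  split. { apply Rmult_le_pos. assumption. left. apply Rdiv_lt_0_compat; lra. }
  split. { repeat apply Rmin_glb_lt; assumption. }
  intros z Nz Hz.
  assert (Hz1 := Rlt_le_trans _ _ _ Hz (Rmin_l _ _)). assert (Hz2 := Rlt_le_trans _ _ _ Hz (Rmin_r _ _)).
  assert (Hz3 := Rlt_le_trans _ _ _ Hz1 (Rmin_l _ _)). assert (Hz4 := Rlt_le_trans _ _ _ Hz1 (Rmin_r _ _)).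
  specialize (H z Nz Hz3). specialize (H' z Nz Hz4).
  rewrite pow_1 in H. rewrite Cmod_mult in H'.
  assert (HK : (m / 2 <= Cmod (K z))%R).
  { pose proof (Cmod_le_diff kappa (kappa - K z)) as T.
    replace (kappa - (kappa - K z)) with (K z) in T by ring.
    replace (Cmod (kappa - K z)) with (Cmod (K z - kappa)) in T
      by (rewrite <- Cmod_opp; f_equal; ring).
    fold m in T.
    assert (M * Cmod z <= m / 2)%R.
    { apply Rle_trans with ((M + 1) * (m / (2 * (M + 1))))%R.
      - pose proof (Cmod_ge_0 z). apply Rmult_le_compat; lra.
      - right. field. lra. }
    lra. }
  pose proof (Cmod_ge_0 (u z)).
  apply Rmult_le_reg_r with (m / 2)%R. lra.
  replace (M' * (2 / m) * Cmod z ^ n * (m / 2))%R with (M' * Cmod z ^ n)%R by (field; lra).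
  eapply Rle_trans; [|exact H']. apply Rmult_le_compat_l; assumption.
Qed.

Lemma bigO_pow_mult (n : nat) (g : C -> C) : bigO 0 g -> bigO n (fun z => z ^ n * g z).
Proof.
  intros Hg. rewrite <- (Nat.add_0_r n) at 1. apply bigO_mult; [|exact Hg].
  exists 1%R, 1%R. split. lra. split. lra. intros z _ _. rewrite Cmod_pow. lra.
Qed.

(* The coefficients [p1, ..., p4] of [Psi (c1 z + c2 z^2 + ...)] determine the [c]'s. *)
Lemma schwarz_expansion (w h5 g5 p5 : C -> C) (a2 a3 a4 a5 c1 c2 c3 c4 : C) (r : R) :
  let p1 := c1 / 2 in
  let p2 := c2 / 2 - c1 ^ 2 / 12 in
  let p3 := c3 / 2 - c1 * c2 / 6 + c1 ^ 3 / 24 in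
  let p4 := c4 / 2 - (2 * c1 * c3 + c2 ^ 2) / 12 + c1 ^ 2 * c2 / 8 - 19 / 720 * c1 ^ 4 in
  p1 = a2 -> p2 = 2 * a3 - a2 * p1 -> p3 = 3 * a4 - a2 * p2 - a3 * p1 ->
  p4 = 4 * a5 - a2 * p3 - a3 * p2 - a4 * p1 ->
  bigO 1 w -> bigO 0 h5 -> bigO 0 g5 -> bigO 0 p5 ->
  (0 < r)%R ->
  (forall z : C, z <> 0 -> (Cmod z < r)%R ->
    1 + z * (2 * a2 + z * (3 * a3 + z * (4 * a4 + z * (5 * a5 + z * g5 z)))) =
    (1 + z * (a2 + z * (a3 + z * (a4 + z * (a5 + z * h5 z))))) *
    (1 + w z * (1 / 2 + w z * (- (1 / 12) + w z * (1 / 24 + w z * (- (19 / 720) + w z * p5 z)))))) ->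
  bigO 5 (fun z => w z - z * (c1 + z * (c2 + z * (c3 + z * c4)))).
Proof.
  intros p1 p2 p3 p4 E1 E2 E3 E4 Ow Oh Og Op Hr E.
  set (v := fun z => z * (c1 + z * (c2 + z * (c3 + z * c4)))).
  set (h := fun z => 1 + z * (a2 + z * (a3 + z * (a4 + z * (a5 + z * h5 z))))).
  set (Q := fun x => x * (1 / 2 + x * (- (1 / 12) + x * (1 / 24 + x * - (19 / 720))))).
  (* The divided difference of [Q] without its constant term:
     [Q x - Q y = (x - y) * (1 / 2 + Rr x y)]. *)
  set (Rr := fun x y => (x + y) * - (1 / 12) + (x * x + x * y + y * y) * (1 / 24)
     + (x * x * x + x * x * y + x * y * y + y * y * y) * - (19 / 720)).
  set (t := fun z => c2 + z * (c3 + z * c4)).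
  (* [e2], [e3], [e4] are the parts of [v^2], [v^3], [v^4] beyond degree 4, divided by [z^5]; [e]
     combines them with the coefficients of [Q]. *)
  set (e2 := fun z => 2 * c1 * c4 + 2 * c2 * c3 + z * (c3 ^ 2 + 2 * c2 * c4 + z * (2 * c3 * c4 + z * c4 ^ 2))).
  set (e3 := fun z => 3 * c1 ^ 2 * (c3 + z * c4) + 3 * c1 * (t z * t z) + z * (t z * (t z * t z))).
  set (e4 := fun z => 4 * c1 ^ 3 * t z + z * (6 * c1 ^ 2 * (t z * t z) + z * (4 * c1 * (t z * (t z * t z))
     + z * (t z * (t z * (t z * t z)))))).
  set (e := fun z => - (1 / 12) * e2 z + 1 / 24 * e3 z + - (19 / 720) * e4 z).
  assert (Qv : forall z, Q (v z) = z * (p1 + z * (p2 + z * (p3 + z * p4))) + z ^ 5 * e z).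
  { intros z. unfold e, e2, e3, e4, Q, v, p1, p2, p3, p4, t. field. }
  assert (Bt : bigO 0 t) by (unfold t; auto 20 with bdd).
  assert (Be : bigO 0 e) by (unfold e, e2, e3, e4; auto 50 with bdd).
  assert (Bh : bigO 0 h) by (unfold h; auto 50 with bdd).
  assert (Ov : bigO 1 v).
  { apply (bigO_mult 1 0). apply bigO_id. auto 20 with bdd. }
  assert (Bw : bigO 0 w) by (apply (bigO_weaken 0 1); [lia|assumption]).
  assert (Bv : bigO 0 v) by (apply (bigO_weaken 0 1); [lia|assumption]).
  assert (ORr : bigO 1 (fun z => Rr (w z) (v z))).
  { apply (bigO_ext 1 (fun z => w z * (- (1 / 12) + (w z + v z) * (1 / 24) + (w z * w z + w z * v z + v z * v z) * - (19 / 720))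
        + v z * (- (1 / 12) + v z * (1 / 24) + v z * v z * - (19 / 720))) _ 1 Rlt_0_1).
    { intros z _ _. unfold Rr. ring. }
    apply bigO_plus; apply (bigO_mult 1 0); auto 50 with bdd. }
  (* Multiplied by this factor, which tends to [1/2], the difference [w - v] becomes
     [h * (Q w - Q v)]. *)
  apply (bigO_cancel 5 _ (fun z => h z * (1 / 2 + Rr (w z) (v z))) (1 / 2)).
  { intros N. apply C1_nz. replace (RtoC 1) with (2 * (1 / 2)) by field. rewrite N. ring. }
  { apply (bigO_ext 1 (fun z => z * ((a2 + z * (a3 + z * (a4 + z * (a5 + z * h5 z)))) * (1 / 2))
        + h z * Rr (w z) (v z)) _ 1 Rlt_0_1).
    { intros z _ _. unfold h. ring. }
    apply bigO_plus. apply (bigO_mult 1 0). apply bigO_id. auto 50 with bdd.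
    apply (bigO_mult 0 1); assumption. }
  (* The coefficients from [z^5] on in the product of the polynomials with coefficients [a2], ...,
     [a5] and [p1], ..., [p4]. *)
  set (rest := fun z => (a2 * p4 + a3 * p3 + a4 * p2 + a5 * p1)
     + z * ((a3 * p4 + a4 * p3 + a5 * p2) + z * ((a4 * p4 + a5 * p3) + z * (a5 * p4)))).
  set (W := fun z => w z * (w z * (w z * (w z * (w z * 1))))).
  assert (OW : bigO 5 W).
  { unfold W. apply (bigO_mult 1 4); [assumption|]. apply (bigO_mult 1 3); [assumption|].
    apply (bigO_mult 1 2); [assumption|]. apply (bigO_mult 1 1); [assumption|].
    apply (bigO_mult 1 0); [assumption|]. apply bigO_const. }
  (* What is left of [h * (Q w - Q v)] once the terms up to [z^4] cancel by the relations between
     the [a]'s and the [p]'s: a multiple of [z^5] and a multiple of [w^5]. *)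
  apply (bigO_ext 5 (fun z => z ^ 5 * (g5 z - h5 z - rest z - h5 z * (z * (p1 + z * (p2 + z * (p3 + z * p4)))) - h z * e z)
      - W z * (h z * p5 z)) _ r Hr).
  - intros z Nz Hz. specialize (E z Nz Hz). fold (h z) in E.
    assert (F : h z * Q (w z) = z * (2 * a2 + z * (3 * a3 + z * (4 * a4 + z * (5 * a5 + z * g5 z))))
       + 1 - h z - W z * (h z * p5 z)).
    { transitivity (h z * (1 + w z * (1 / 2 + w z * (- (1 / 12) + w z * (1 / 24 + w z * (- (19 / 720) + w z * p5 z)))))
        - h z - W z * (h z * p5 z)).
      - unfold Q, W. ring.
      - rewrite <- E. ring. }
    change (z * (c1 + z * (c2 + z * (c3 + z * c4)))) with (v z).
    transitivity (h z * Q (w z) - h z * Q (v z)).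
    2: { unfold Q, Rr. ring. }
    rewrite F, Qv. clearbody p1 p2 p3 p4. unfold rest.
    replace (h z * (z * (p1 + z * (p2 + z * (p3 + z * p4))) + z ^ 5 * e z))
      with (h z * (z * (p1 + z * (p2 + z * (p3 + z * p4)))) + z ^ 5 * (h z * e z)) by ring.
    unfold h at 2 4. rewrite E4, E3, E2, E1. unfold h. ring.
  - apply bigO_minus.
    + apply bigO_pow_mult. unfold rest. auto 50 with bdd.
    + apply (bigO_mult 5 0). assumption. auto with bdd.
Qed.

Lemma Cmod_Cmult_R (x : R) (z : C) : (Cmod (x * z) ^ 2 = x ^ 2 * Cmod z ^ 2)%R.
Proof. rewrite Cmod_mult, Cmod_R, Rpow_mult_distr, pow2_abs. reflexivity. Qed.

Lemma schwarz_functional_le_1 (w : C -> C) (c1 c2 c3 c4 : C) :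
  punctured_holomorphic w ->
  (forall z, in_disc z -> (Cmod (w z) <= 1)%R) ->
  bigO 5 (fun z => w z - z * (c1 + z * (c2 + z * (c3 + z * c4)))) ->
  (Cmod (c4 + c1 * c3 / 3 - 5 / 12 * c2 ^ 2 - 5 / 36 * c1 ^ 2 * c2 - c1 ^ 4 / 15) <= 1)%R.
Proof.
  intros Hw Bw Ow.
  (* The first unit vector gives [|c1| <= 1]. *)
  assert (T0 := toeplitz_contraction w c1 c2 c3 c4 1 0 0 0 Hw Bw Ow).
  assert (T := toeplitz_contraction w c1 c2 c3 c4 1 (RtoC (1 / 3) * c1)
    (RtoC (- (5 / 12)) * (c2 + c1 ^ 2 / 3)) (RtoC (- (1 / 15)) * (c1 * c1 * c1)) Hw Bw Ow).
  rewrite !Cmult_1_r, Cmod_1, Cmod_0 in T0.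
  rewrite !Cmult_1_r, Cmod_1, !Cmod_Cmult_R in T.
  replace (c2 + c1 * (RtoC (1 / 3) * c1)) with (c2 + c1 ^ 2 / 3) in T
    by (rewrite RtoC_div by lra; field).
  match type of T with (_ + _ + _ + Cmod ?X ^ 2 <= _)%R => replace X with
   (c4 + c1 * c3 / 3 - 5 / 12 * c2 ^ 2 - 5 / 36 * c1 ^ 2 * c2 - c1 ^ 4 / 15) in T end.
  2: { rewrite !RtoC_opp, !RtoC_div by lra. field. }
  set (L := c4 + c1 * c3 / 3 - 5 / 12 * c2 ^ 2 - 5 / 36 * c1 ^ 2 * c2 - c1 ^ 4 / 15) in *.
  assert (Q : (Cmod (c1 * c1 * c1) ^ 2 = (Cmod c1 ^ 2) * (Cmod c1 ^ 2) * (Cmod c1 ^ 2))%R)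
    by (rewrite !Cmod_mult; ring).
  rewrite Q in T.
  pose proof (pow2_ge_0 (Cmod c1)). pose proof (pow2_ge_0 (Cmod (c2 + c1 ^ 2 / 3))).
  set (q1 := (Cmod c1 ^ 2)%R) in *. set (q2 := (Cmod (c2 + c1 ^ 2 / 3) ^ 2)%R) in *.
  assert (q11 : (q1 <= 1)%R).
  { pose proof (pow2_ge_0 (Cmod (c2 + c1 * 0))). pose proof (pow2_ge_0 (Cmod (c3 + c2 * 0 + c1 * 0))).
    pose proof (pow2_ge_0 (Cmod (c4 + c3 * 0 + c2 * 0 + c1 * 0))). lra. }
  match type of T with (_ + _ + Cmod ?X ^ 2 + _ <= _)%R => pose proof (pow2_ge_0 (Cmod X)) end.
  assert (q13 : (q1 * q1 * q1 <= q1)%R) by (assert (q1 * q1 <= q1)%R by nra; nra).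
  (* With [q1^3 <= q1] the inequality [T] leaves [|L|^2 <= 1 - (199/225) q1 - (119/144) q2]. *)
  assert (L2 : (Cmod L ^ 2 <= 1)%R) by nra.
  pose proof (Cmod_ge_0 L). nra.
Qed.

Lemma bigO_1_zero (w : C -> C) (l : C) : is_Cderive w 0 l -> w 0 = 0 -> bigO 1 w.
Proof.
  rewrite is_Cderive_eps. intros H H0. destruct (H 1%R Rlt_0_1) as (d & Hd & Hy).
  exists (1 + Cmod l)%R, d. split. { pose proof (Cmod_ge_0 l). lra. } split. assumption.
  intros z _ Hz. specialize (Hy z). replace (z - 0) with z in Hy by ring. specialize (Hy Hz).
  rewrite H0 in Hy. replace (w z - 0 - l * z) with (w z - l * z) in Hy by ring.
  pose proof (Cmod_le_diff (w z) (l * z)) as T. rewrite Cmod_mult in T. rewrite pow_1. lra.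
Qed.

Lemma bigO_CPSeries_comp (M rho : R) (a : nat -> C) (w : C -> C) :
  geom_bounded M rho a -> bigO 1 w -> bigO 0 (fun z => CPSeries a (w z)).
Proof.
  intros Ha (K & d & HK & Hd & H). pose proof Ha as (HM & Hr & _).
  assert (He : (0 < / (2 * rho * (K + 1)))%R).
  { apply Rinv_0_lt_compat. repeat apply Rmult_lt_0_compat; lra. }
  exists (4 * M)%R, (Rmin d (/ (2 * rho * (K + 1)))). split. lra.
  split. now apply Rmin_glb_lt.
  intros z Nz Hz.
  assert (Hz1 := Rlt_le_trans _ _ _ Hz (Rmin_l _ _)). assert (Hz2 := Rlt_le_trans _ _ _ Hz (Rmin_r _ _)).
  specialize (H z Nz Hz1). rewrite pow_1 in H.
  assert (Hw : (rho * Cmod (w z) <= 1 / 2)%R).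
  { apply Rle_trans with (rho * ((K + 1) * / (2 * rho * (K + 1))))%R.
    - apply Rmult_le_compat_l. lra. eapply Rle_trans. exact H.
      pose proof (Cmod_ge_0 z). apply Rmult_le_compat; lra.
    - right. field. lra. }
  eapply Rle_trans. apply (is_Cseries_CPSeries M rho a (w z) Ha ltac:(lra)).
  simpl. apply Rmult_le_reg_r with (1 - rho * Cmod (w z))%R. lra.
  unfold Rdiv. rewrite Rmult_assoc, Rinv_l by lra. nra.
Qed.

Lemma CPSeries_split5 (M rho : R) (a : nat -> C) (z : C) :
  geom_bounded M rho a -> (rho * Cmod z < 1)%R ->
  CPSeries a z = a 0%nat + z * (a 1%nat + z * (a 2%nat + z * (a 3%nat + z * (a 4%nat
    + z * CPSeries (fun n => a (S (S (S (S (S n)))))) z)))).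
Proof.
  intros Ha Hz.
  assert (G1 := geom_bounded_shift _ _ _ Ha). assert (G2 := geom_bounded_shift _ _ _ G1).
  assert (G3 := geom_bounded_shift _ _ _ G2). assert (G4 := geom_bounded_shift _ _ _ G3).
  rewrite (CPSeries_cons _ _ _ z Ha Hz), (CPSeries_cons _ _ _ z G1 Hz), (CPSeries_cons _ _ _ z G2 Hz),
    (CPSeries_cons _ _ _ z G3 Hz), (CPSeries_cons _ _ _ z G4 Hz).
  reflexivity.
Qed.

(** The factor [n + 1] is at most [2^n], at the price of doubling [rho]. *)
Lemma geom_bounded_Cderive_coeff (M : R) (a : nat -> C) :
  geom_bounded M 2 a -> geom_bounded (2 * M) 4 (Cderive_coeff a).
Proof.
  intros (HM & _ & H). split. lra. split. lra. intros n. unfold Cderive_coeff.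
  rewrite Cmod_mult, Cmod_R, Rabs_pos_eq by apply pos_INR. specialize (H (S n)).
  assert (B : (INR (S n) <= 2 ^ n)%R).
  { clear H. induction n as [|n IH]. simpl. lra. rewrite S_INR. simpl (2 ^ S n)%R.
    pose proof (pow_R1_Rle 2 n ltac:(lra)). lra. }
  replace (2 * M * 4 ^ n)%R with (2 ^ n * (M * 2 ^ S n))%R.
  - apply Rmult_le_compat; try assumption. apply pos_INR. apply Cmod_ge_0.
  - replace (4 ^ n)%R with (2 ^ n * 2 ^ n)%R by (rewrite <- Rpow_mult_distr; f_equal; lra).
    simpl. ring.
Qed.

Lemma class_SG_bound (f : C -> C) (a : nat -> C) :
  class_SG f -> taylor_on_disc f a -> (Cmod (a 3%nat ^ 2 - a 5%nat) <= 1 / 8)%R.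
Proof.
  intros ((_ & f0 & f1) & Nf & (_ & _ & w & Hw & w0 & Bw & Ew)) Ta.
  destruct (taylor_geom_bounded f a Ta) as (M & Ga & Ef).
  destruct gregory_series as (P & (P0 & P1 & P2 & P3 & P4 & PB) & HP).
  assert (GP := geom_bounded_RtoC P PB).
  assert (Gs := geom_bounded_shift _ _ _ Ga). assert (Gd := geom_bounded_Cderive_coeff _ _ Ga).
  assert (Df : forall z, (2 * Cmod z < 1)%R -> is_Cderive f z (CPSeries (Cderive_coeff a) z)).
  { intros z Hz. apply (is_Cderive_ext_loc (CPSeries a) f z _ (1 / 2 - Cmod z)). lra.
    - intros x Hx. symmetry. apply Ef.
      pose proof (Cmod_triangle (x - z) z) as T. replace (x - z + z) with x in T by ring. lra.
    - now apply (is_Cderive_CPSeries M 2). }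
  assert (a0 : a 0%nat = 0).
  { rewrite <- (CPSeries_at_0 M 2 a Ga), <- Ef; [assumption|]. rewrite Cmod_0. lra. }
  assert (a1 : a 1%nat = 1).
  { rewrite (is_C_derive_unique f 0 (CPSeries (Cderive_coeff a) 0)) in f1.
    - rewrite (CPSeries_at_0 _ _ _ Gd) in f1. rewrite <- f1. unfold Cderive_coeff. simpl. ring.
    - apply Df. rewrite Cmod_0. lra. }
  destruct (Hw 0) as [lw Hlw]. { unfold in_disc. rewrite Cmod_0. lra. }
  assert (Ow : bigO 1 w) by exact (bigO_1_zero w lw Hlw w0).
  (* [p1], ..., [p4] are the Taylor coefficients of [z f' / f]. The [c]'s then solve the triangular
     system for [Psi] composed with [w], in which each new [c] occurs with the factor [1/2]. *)
  set (p1 := a 2%nat). set (p2 := 2 * a 3%nat - a 2%nat * p1).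
  set (p3 := 3 * a 4%nat - a 2%nat * p2 - a 3%nat * p1).
  set (p4 := 4 * a 5%nat - a 2%nat * p3 - a 3%nat * p2 - a 4%nat * p1).
  set (c1 := 2 * p1). set (c2 := 2 * (p2 + c1 ^ 2 / 12)).
  set (c3 := 2 * (p3 + c1 * c2 / 6 - c1 ^ 3 / 24)).
  set (c4 := 2 * (p4 + (2 * c1 * c3 + c2 ^ 2) / 12 - c1 ^ 2 * c2 / 8 + 19 / 720 * c1 ^ 4)).
  assert (E1 : c1 / 2 = p1) by (unfold c1; field).
  assert (E2 : c2 / 2 - c1 ^ 2 / 12 = p2) by (unfold c2; field).
  assert (E3 : c3 / 2 - c1 * c2 / 6 + c1 ^ 3 / 24 = p3) by (unfold c3; field).
  assert (E4 : c4 / 2 - (2 * c1 * c3 + c2 ^ 2) / 12 + c1 ^ 2 * c2 / 8 - 19 / 720 * c1 ^ 4 = p4)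
    by (unfold c4; field).
  assert (L : (Cmod (c4 + c1 * c3 / 3 - 5 / 12 * c2 ^ 2 - 5 / 36 * c1 ^ 2 * c2 - c1 ^ 4 / 15) <= 1)%R).
  { apply (schwarz_functional_le_1 w).
    - intros z Hz _. exact (Hw z Hz).
    - intros z Hz. left. now apply Bw.
    (* The radius [1/4] is where the series of the derivative, with [rho = 4], is under control. *)
    - apply (schwarz_expansion w
        (CPSeries (fun n => a (S (S (S (S (S (S n))))))))
        (CPSeries (fun n => Cderive_coeff a (S (S (S (S (S n)))))))
        (fun z => CPSeries (fun n => RtoC (P (S (S (S (S (S n))))))) (w z))
        (a 2%nat) (a 3%nat) (a 4%nat) (a 5%nat) c1 c2 c3 c4 (1 / 4)).
      + exact E1.
      + rewrite E2, E1. reflexivity.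
      + rewrite E3, E2, E1. reflexivity.
      + rewrite E4, E3, E2, E1. reflexivity.
      + exact Ow.
      + eapply bigO_CPSeries.
        exact (geom_bounded_shift _ _ _ (geom_bounded_shift _ _ _ (geom_bounded_shift _ _ _
          (geom_bounded_shift _ _ _ (geom_bounded_shift _ _ _ Gs))))).
      + eapply bigO_CPSeries.
        exact (geom_bounded_shift _ _ _ (geom_bounded_shift _ _ _ (geom_bounded_shift _ _ _
          (geom_bounded_shift _ _ _ (geom_bounded_shift _ _ _ Gd))))).
      + eapply bigO_CPSeries_comp; [|exact Ow].
        exact (geom_bounded_shift _ _ _ (geom_bounded_shift _ _ _ (geom_bounded_shift _ _ _
          (geom_bounded_shift _ _ _ (geom_bounded_shift _ _ _ GP))))).
      + lra.
      + intros z Nz Hz.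
        assert (Dz : in_disc z) by (unfold in_disc; lra).
        assert (Ez := Ew z Dz). unfold zf'_over_f in Ez.
        destruct (Ceq_dec z 0) as [|_]; [contradiction|].
        rewrite (is_C_derive_unique f z _ (Df z ltac:(lra))) in Ez.
        rewrite HP in Ez by (apply Bw, Dz).
        assert (Fz : f z <> 0) by now apply Nf.
        (* As [f z] is not 0, the quotient clears to [z f' = f Psi(w)]; since [a 0 = 0], a factor
           [z] can be cancelled from both sides at the end. *)
        apply (f_equal (fun u => u * f z)) in Ez.
        replace (z * CPSeries (Cderive_coeff a) z / f z * f z) with (z * CPSeries (Cderive_coeff a) z)
          in Ez by (field; assumption).
        rewrite Ef in Ez by lra.
        rewrite (CPSeries_cons M 2 a z Ga) in Ez by lra. rewrite a0 in Ez.
        rewrite (CPSeries_split5 _ _ _ z Gs) in Ez by lra.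
        rewrite (CPSeries_split5 _ _ _ z Gd) in Ez by lra.
        rewrite (CPSeries_split5 _ _ _ (w z) GP) in Ez
          by (pose proof (Bw z Dz); lra).
        rewrite a1, P0, P1, P2, P3, P4 in Ez.
        rewrite !RtoC_opp, !RtoC_div in Ez by lra.
        set (g5 := CPSeries (fun n => Cderive_coeff a (S (S (S (S (S n)))))) z) in *.
        unfold Cderive_coeff in Ez. rewrite a1 in Ez.
        replace (RtoC (INR 1)) with (RtoC 1) in Ez by (f_equal; simpl; ring).
        replace (RtoC (INR 2)) with (RtoC 2) in Ez by (f_equal; simpl; ring).
        replace (RtoC (INR 3)) with (RtoC 3) in Ez by (f_equal; simpl; ring).
        replace (RtoC (INR 4)) with (RtoC 4) in Ez by (f_equal; simpl; ring).
        replace (RtoC (INR 5)) with (RtoC 5) in Ez by (f_equal; simpl; ring).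
        apply (f_equal (fun u => u / z)) in Ez.
        match type of Ez with ?A = ?B =>
          match goal with |- ?A' = ?B' =>
            transitivity A; [field; assumption|rewrite Ez; field; assumption] end end. }
  replace (a 3%nat ^ 2 - a 5%nat) with
    (RtoC (- (1 / 8)) * (c4 + c1 * c3 / 3 - 5 / 12 * c2 ^ 2 - 5 / 36 * c1 ^ 2 * c2 - c1 ^ 4 / 15)).
  - rewrite Cmod_mult, Cmod_R, Rabs_Ropp, Rabs_pos_eq by lra. lra.
  - rewrite RtoC_opp, RtoC_div by lra. unfold c4, c3, c2, c1, p4, p3, p2, p1. field.
Qed.

Theorem theorem4p1 :
  (forall (f : C -> C) (a : nat -> C),
     class_SG f -> taylor_on_disc f a ->
     (Cmod (a 3%nat ^ 2 - a 5%nat) <= 1 / 8)%R) /\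
  (exists (f : C -> C) (a : nat -> C),
     class_SG f /\ taylor_on_disc f a /\
     Cmod (a 3%nat ^ 2 - a 5%nat) = (1 / 8)%R).
Proof.
  split.
  - exact class_SG_bound.
  - exact extremal_function.
Qed.
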